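(* Let $\alpha\in(0,2]$, $\beta\in(0,1]$, $c\in\mathbb{R}$, and set $\gamma=\frac{2^{1-\alpha}(2^\alpha-1)}{3}$. Let $u_0(x,t)=\frac{4c}{3}\cos^2\left(\frac{x}{4}\right)$ and let $u_{n+1}$, $n\ge 0$, be determined recursively by $$\partial_t^\beta u_{n+1}=-\partial_x w_n+\partial_x(-\partial_{xx})^{\frac{\alpha}{2}}w_n,\qquad u_{n+1}(x,0)=0,\qquad w_n=\sum_{k=0}^n u_ku_{n-k}.$$ Then for every $n\ge 1$, $$u_n(x,t)=(-1)^{\lfloor n/2\rfloor}\,\frac{2^{n+1-n\alpha}(2^\alpha-1)^n c^{n+1}t^{\beta n}}{3^{n+1}\,\Gamma(1+\beta n)}\,\psi_n\!\left(\frac{x}{2}\right),\qquad \psi_n=\begin{cases}\cos,& n\text{ even},\\ \sin,& n\text{ odd}.\end{cases}$$ The series $\sum_{n=0}^\infty u_n(x,t)$ converges absolutely for all $x\in\mathbb{R}$, $t\ge 0$, and its sum $$u(x,t)=\frac{2c}{3}\left\{1+\cos\left(\frac{x}{2}\right)E_{2\beta}\left(-(\gamma ct^\beta)^2\right)+\sin\left(\frac{x}{2}\right)\gamma ct^\beta E_{2\beta,1+\beta}\left(-(\gamma ct^\beta)^2\right)\right\}$$ is a solution of the fractional $K(2,2)$ equation $$\partial_t^\beta u+\partial_x(u^2)-\partial_x(-\partial_{xx})^{\frac{\alpha}{2}}(u^2)=0$$ with $u(x,0)=\frac{4c}{3}\cos^2\left(\frac{x}{4}\right)$. If $\alpha=2$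 and $\beta=1$, then $u(x,t)=\frac{4c}{3}\cos^2\left(\frac{x-ct}{4}\right)$.
   Context: For $\beta\in(0,1)$, $\partial_t^\beta$ is the Caputo derivative $\partial_t^\beta f(t)=\frac{1}{\Gamma(1-\beta)}\int_0^t f'(\tau)(t-\tau)^{-\beta}\,d\tau$; for $\beta=1$ it is the ordinary derivative. The problem $\partial_t^\beta v=F(t)$, $v(0)=v_0$, is solved by $v(t)=v_0+\frac{1}{\Gamma(\beta)}\int_0^tF(\tau)(t-\tau)^{\beta-1}d\tau$; the recursion for $u_{n+1}$ is understood in this sense. $(-\partial_{xx})^{\alpha/2}$ is the Fourier multiplier $|\xi|^\alpha$ in $x$; on periodic functions it acts by $\cos(kx)\mapsto|k|^\alpha\cos(kx)$, $\sin(kx)\mapsto|k|^\alpha\sin(kx)$, and it annihilates constants. The Mittag-Leffler function is $E_{a,b}(z)=\sum_{n=0}^\infty\frac{z^n}{\Gamma(an+b)}$ ($a,b>0$), with $E_a:=E_{a,1}$. *)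

(* Defs.v *)
From HB Require Import structures.
From mathcomp Require Import all_boot all_order all_algebra.
From mathcomp Require Import all_classical all_reals all_analysis.

Set Implicit Arguments.
Unset Strict Implicit.
Unset Printing Implicit Defensive.

Import Order.TTheory GRing.Theory Num.Theory.
Import numFieldNormedType.Exports.

Local Open Scope classical_set_scope.
Local Open Scope ring_scope.

Section special_functions.
Context {R : realType}.
Implicit Types a b z : R.

Definition Gamma a : R :=
  \int[lebesgue_measure]_(s in `]0, +oo[) (s `^ (a - 1) * expR (- s)).

Definition mittag_leffler a b z : R :=
  limn (series (fun n => z ^+ n / Gamma (a * n%:R + b))).

End special_functions.

Section caputo.
Context {R : realType}.
Implicit Types (beta t : R) (f v F : R -> R).

Definition caputo beta f t : R :=
  if beta == 1 then derive1 f t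
  else (Gamma (1 - beta))^-1 *
       \int[lebesgue_measure]_(s in `]0, t[) (derive1 f s * (t - s) `^ (- beta)).

(* [caputo] is a total function; this says that its value at [t] is genuine. *)
Definition caputo_derivable beta f t : Prop :=
  if beta == 1 then derivable f t 1
  else (forall s, s \in `]0, t[ -> derivable f s 1) /\
       lebesgue_measure.-integrable `]0, t[
         (fun s => (derive1 f s * (t - s) `^ (- beta))%:E).

(* [v] solves the problem "Caputo derivative of order beta equal to F,
   v(0) = v0", in the integrated sense. *)
Definition solves_caputo_ivp beta (v0 : R) F v : Prop :=
  forall t, 0 <= t ->
    v t = v0 + (Gamma beta)^-1 *
      \int[lebesgue_measure]_(s in `]0, t[) (F s * (t - s) `^ (beta - 1)).

End caputo.

(* Functions of period [L]: the Fourier multiplier |xi|^alpha acts on the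
   Fourier series of f, whose frequencies are xi_k = 2 pi k / L. *)
Section fractional_laplacian.
Context {R : realType}.
Implicit Types (L alpha x : R) (f : R -> R) (k : nat).

Definition freq L k : R := 2 * pi * k%:R / L.

Definition fourier_cos L f k : R :=
  2 / L * \int[lebesgue_measure]_(y in `[0, L]) (f y * cos (freq L k * y)).

Definition fourier_sin L f k : R :=
  2 / L * \int[lebesgue_measure]_(y in `[0, L]) (f y * sin (freq L k * y)).

(* For alpha > 0 the term k = 0 vanishes, so it does not matter that the mean
   of f is half of [fourier_cos L f 0]. *)
Definition frac_laplacian L alpha f x : R :=
  limn (series (fun k => freq L k `^ alpha *
    (fourier_cos L f k * cos (freq L k * x) +
     fourier_sin L f k * sin (freq L k * x)))).

(* A domain on which [frac_laplacian L alpha] is a genuine sum: f is then the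
   sum of its Fourier series, and the series of [frac_laplacian L alpha f]
   converges absolutely and uniformly. *)
Definition frac_laplacian_dom L alpha f : Prop :=
  [/\ periodic f L, continuous f &
      cvgn (series (fun k => freq L k `^ alpha *
        (`|fourier_cos L f k| + `|fourier_sin L f k|)))].

End fractional_laplacian.

Section fractional_K22.
Context {R : realType}.
Implicit Types (L alpha beta c x t : R) (u : R -> R -> R) (n : nat).

Definition K22_w (u_ : nat -> R -> R -> R) n x t : R := \sum_(k < n.+1) u_ k x t * u_ (n - k)%N x t.

Definition K22_recursion L alpha beta c (u_ : nat -> R -> R -> R) : Prop :=
  (forall x t, 0 <= t -> u_ 0%N x t = 4 * c / 3 * cos (x / 4) ^+ 2) /\
  (forall n x, solves_caputo_ivp beta 0
     (fun t => - derive1 (fun y => K22_w u_ n y t) x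
               + derive1 (frac_laplacian L alpha (fun y => K22_w u_ n y t)) x)
     (u_ n.+1 x)).

(* Pointwise solution, of period [L] in x. The equation is required for t > 0
   only, since for beta < 1 a Caputo derivative vanishes trivially at t = 0;
   continuity up to t = 0 ties the solution to its initial value. *)
Definition K22_solution L alpha beta u : Prop :=
  (forall x, {within `[0, +oo[, continuous (u x)}) /\
  (forall x t, 0 < t ->
    [/\ caputo_derivable beta (u x) t,
        frac_laplacian_dom L alpha (fun y => u y t ^+ 2),
        derivable (fun y => u y t ^+ 2) x 1,
        derivable (frac_laplacian L alpha (fun y => u y t ^+ 2)) x 1 &
        caputo beta (u x) t + derive1 (fun y => u y t ^+ 2) x
          - derive1 (frac_laplacian L alpha (fun y => u y t ^+ 2)) x = 0]).

Definition K22_psi n : R -> R := if odd n then sin else cos.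

End fractional_K22.

(* Main.v *)
Require Import Defs.
From HB Require Import structures.
From mathcomp Require Import all_boot all_order all_algebra.
From mathcomp Require Import all_classical all_reals all_analysis.
From mathcomp Require Import measurable_realfun ring lra.
Import Order.TTheory GRing.Theory Num.Theory.
Import numFieldNormedType.Exports.
Local Open Scope classical_set_scope.
Local Open Scope ring_scope.

(** The product of two functions [d + A cos (x/2) + B sin (x/2)] has frequencies
    [0], [1/2] and [1] only, and [1 - |xi|^alpha] vanishes at frequency [1]. Hence
    [- d/dx + d/dx (- d^2/dx^2)^(alpha/2)] sees only the frequency [1/2] part of
    [u^2] and of [w_n], which is linear in the oscillating part: the recursion
    and the equation both reduce to the linear problem
    [D_t^beta v = - 2 gamma c d/dx v]. The recursion is then solved by the Beta integral,
    [Gamma a * Gamma b = Gamma (a + b) * B (a, b)], which follows from Tonelli's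
    theorem and an affine change of variables. For the Caputo derivative of the
    sum, the series is an entire function of [t^beta], differentiated term by term
    and integrated by dominated convergence with a multiple of
    [s^(beta - 1) (t - s)^(- beta)] as dominating function. *)

Set Implicit Arguments.
Unset Strict Implicit.
Unset Printing Implicit Defensive.

(** * Gamma and Beta integrals *)

Section beta_integral.
Context {R : realType}.
Notation mu := (@lebesgue_measure R).

(** By uniqueness of Lebesgue measure it suffices to compare both sides on half-open intervals,
    whose preimages are again half-open because [k] is positive. *)
Lemma lebesgue_measure_affine (k b : R) (A : set R) : 0 < k -> measurable A ->
  mu A = (k%:E * mu ((fun x : R => (k * x + b)%R) @^-1` A))%E.
Proof.
move=> k0 mA.
pose f (x : measurableTypeR R) : measurableTypeR R := k * x + b.
have mf : measurable_fun [set: measurableTypeR R] f.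
  by apply: measurable_funD => //; exact: measurable_funM.
pose nu := pushforward mu f.
pose K : {nonneg R} := NngNum (ltW k0).
rewrite (@lebesgue_measure_unique R (mscale K nu)) // => _ [[x y] _ <-].
change (mu [set` `]x, y]] = (k%:E * mu (f @^-1` [set` `]x, y]])))%E.
have -> : f @^-1` `]x, y] = [set` `](x - b) / k, (y - b) / k]].
  by apply/seteqP; split => z /=;
    rewrite !in_itv/= ltr_pdivrMr// ler_pdivlMr// ltrBlDr lerBrDr (mulrC z).
rewrite lebesgue_measure_itv/= [in RHS]lebesgue_measure_itv/=.
rewrite !lte_fin ltr_pM2r ?invr_gt0// ltrD2r.
case: ifPn => _; last by rewrite mule0.
by rewrite -!EFinD -EFinM; congr EFin; field; rewrite gt_eqF.
Qed.

Lemma ge0_integral_affine (f : R -> \bar R) (k b : R) : 0 < k ->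
  measurable_fun setT f -> (forall x, 0 <= f x)%E ->
  (\int[mu]_x f x = k%:E * \int[mu]_x f (k * x + b)%R)%E.
Proof.
move=> k0 mf f0.
pose g (x : measurableTypeR R) : measurableTypeR R := k * x + b.
have mg : measurable_fun [set: measurableTypeR R] g.
  by apply: measurable_funD => //; exact: measurable_funM.
pose K : {nonneg R} := NngNum (ltW k0).
rewrite (eq_measure_integral (mscale K (pushforward mu g))).
  rewrite ge0_integral_mscale// (ge0_integral_pushforward mg) //.
move=> A mA _.
exact: (lebesgue_measure_affine b k0).
Qed.

(* The indicator matters: [x `^ p] is [1], not [0], for [x < 0]. *)
Definition pow_pos (a x : R) : R := \1_`]0, +oo[ x * x `^ (a - 1).

Lemma pow_posE a x : 0 < x -> pow_pos a x = x `^ (a - 1).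
Proof. by move=> x0; rewrite /pow_pos indicE mem_set ?mul1r//= in_itv/= x0. Qed.

Lemma pow_pos_le0 a x : x <= 0 -> pow_pos a x = 0.
Proof.
by move=> x0; rewrite /pow_pos indicE memNset ?mul0r//= in_itv/= andbT ltNge x0.
Qed.

Lemma pow_pos_ge0 a x : 0 <= pow_pos a x.
Proof. by rewrite /pow_pos mulr_ge0 ?powR_ge0. Qed.

Lemma measurable_pow_pos a : measurable_fun setT (pow_pos a).
Proof.
apply: measurable_funM; last exact: measurable_powR.
by apply: measurable_indic; exact: measurable_itv.
Qed.

Lemma pow_posM a z x : 0 < z -> pow_pos a (z * x) = z `^ (a - 1) * pow_pos a x.
Proof.
move=> z0; have [x0|x0] := leP x 0.
  by rewrite !pow_pos_le0 ?mulr0// pmulr_rle0.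
by rewrite !pow_posE ?mulr_gt0// powRM// ltW.
Qed.

Definition gamma_integrand (a x : R) : R := pow_pos a x * expR (- x).

(** Both integrals run over the whole line and take extended real values, so that Tonelli's theorem
    and affine substitutions apply before finiteness is known. *)
Definition egamma a : \bar R := (\int[mu]_x (gamma_integrand a x)%:E)%E.
Definition ebeta a b : \bar R := (\int[mu]_x (pow_pos a x * pow_pos b (1 - x))%:E)%E.

Lemma gamma_integrand_ge0 a x : 0 <= gamma_integrand a x.
Proof. by rewrite mulr_ge0 ?pow_pos_ge0 ?expR_ge0. Qed.

Lemma measurable_gamma_integrand a : measurable_fun setT (gamma_integrand a).
Proof.
apply: measurable_funM; first exact: measurable_pow_pos.
by apply: measurableT_comp => //; exact: measurable_expR.
Qed.

Lemma egamma_ge0 a : (0 <= egamma a)%E.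
Proof. by apply: integral_ge0 => x _; rewrite lee_fin gamma_integrand_ge0. Qed.

Lemma ebeta_ge0 a b : (0 <= ebeta a b)%E.
Proof. by apply: integral_ge0 => x _; rewrite lee_fin mulr_ge0 ?pow_pos_ge0. Qed.

Lemma measurable_convol_pow a b z :
  measurable_fun setT (fun x => pow_pos a x * pow_pos b (z - x)).
Proof.
apply: measurable_funM; first exact: measurable_pow_pos.
apply: (measurableT_comp (measurable_pow_pos b)) => //; exact: measurable_funB.
Qed.

(** Replacing [x] by [z * x] pulls out [z] to the powers [1], [a - 1] and [b - 1]. *)
Lemma integral_convol_pow a b z : 0 < z ->
  (\int[mu]_x (pow_pos a x * pow_pos b (z - x))%:E = (z `^ (a + b - 1))%:E * ebeta a b)%E.
Proof.
move=> z0.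
have mf := measurable_convol_pow a b z.
have := @ge0_integral_affine (fun x => (pow_pos a x * pow_pos b (z - x))%:E) z 0 z0.
move=> -> ; last 2 first.
- exact/measurable_EFinP.
- by move=> x; rewrite lee_fin mulr_ge0 ?pow_pos_ge0.
under eq_integral => x _.
  rewrite addr0 (_ : z - z * x = z * (1 - x)); last by ring.
  rewrite !pow_posM// mulrACA EFinM; over.
rewrite ge0_integralZl//=; last 3 first.
- by apply/measurable_EFinP; exact: measurable_convol_pow.
- by move=> x _; rewrite lee_fin mulr_ge0 ?pow_pos_ge0.
- by rewrite lee_fin mulr_ge0 ?powR_ge0.
rewrite muleA -EFinM; congr (_%:E * _)%E.
have zD p q : z `^ p * z `^ q = z `^ (p + q) by rewrite powRD// (gt_eqF z0) implybT.
rewrite -[X in X * _](powRr1 (ltW z0)) !zD; congr powR; ring.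
Qed.

(** The shift [y = z - x] in the inner integral turns the product into a double integral in [x] and
    [z]. Integrating in [x] first leaves the convolution of two powers, which is [ebeta a b] times a
    power of [z]. *)
Lemma ebeta_egamma a b : (ebeta a b * egamma (a + b) = egamma a * egamma b)%E.
Proof.
have H1 : (egamma a * egamma b =
   \int[mu]_x \int[mu]_z (pow_pos a x * pow_pos b (z - x) * expR (- z))%:E)%E.
  rewrite {1}/egamma -ge0_integralZr//; last 3 first.
  - by apply/measurable_EFinP; exact: measurable_gamma_integrand.
  - by move=> x _; rewrite lee_fin gamma_integrand_ge0.
  - exact: egamma_ge0.
  apply: eq_integral => x _.
  rewrite /egamma -ge0_integralZl//; last 3 first.
  - by apply/measurable_EFinP; exact: measurable_gamma_integrand.
  - by move=> y _; rewrite lee_fin gamma_integrand_ge0.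
  - by rewrite lee_fin gamma_integrand_ge0.
  have := @ge0_integral_affine
    (fun y => (gamma_integrand a x)%:E * (gamma_integrand b y)%:E)%E 1 (- x) ltr01.
  move=> ->; last 2 first.
  - apply: measurable_funeM; apply/measurable_EFinP.
    exact: measurable_gamma_integrand.
  - by move=> y; rewrite -EFinM lee_fin mulr_ge0 ?gamma_integrand_ge0.
  rewrite mul1e.
  apply: eq_integral => z _; rewrite mul1r -EFinM; congr EFin.
  rewrite /gamma_integrand mulrACA -expRD; congr (_ * expR _); ring.
rewrite H1.
have := @fubini_tonelli _ _ _ _ R mu mu (fun xz : measurableTypeR R * measurableTypeR R =>
  (pow_pos a xz.1 * pow_pos b (xz.2 - xz.1) * expR (- xz.2))%:E).
move=> ->; last 2 first.
- apply/measurable_EFinP; apply: measurable_funM; first apply: measurable_funM.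
  + apply: (measurableT_comp (measurable_pow_pos a)); exact: measurable_fst.
  + apply: (measurableT_comp (measurable_pow_pos b)); apply: measurable_funB.
      exact: measurable_snd.
    exact: measurable_fst.
  + apply: (measurableT_comp (@measurable_expR R)).
    apply: (measurableT_comp (@oppr_measurable R setT)); exact: measurable_snd.
- by move=> x; rewrite lee_fin mulr_ge0 ?expR_ge0// mulr_ge0// pow_pos_ge0.
transitivity (\int[mu]_z ((gamma_integrand (a + b) z)%:E * ebeta a b))%E.
  rewrite ge0_integralZr//; first by rewrite muleC.
  - by apply/measurable_EFinP; exact: measurable_gamma_integrand.
  - by move=> x _; rewrite lee_fin gamma_integrand_ge0.
  - exact: ebeta_ge0.
apply: eq_integral => z _ /=.
have mc : measurable_fun setT (fun x => (pow_pos a x * pow_pos b (z - x))%:E).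
  by apply/measurable_EFinP; exact: measurable_convol_pow.
under eq_integral => x _ do rewrite EFinM muleC.
rewrite (@ge0_integralZl _ _ R mu setT measurableT _ mc); last 2 first.
- by move=> x _; rewrite lee_fin mulr_ge0 ?pow_pos_ge0.
- by rewrite lee_fin expR_ge0.
(* For [z <= 0] the factors [pow_pos a x] and [pow_pos b (z - x)] are never both nonzero. *)
have [z0|z0] := leP z 0.
  rewrite /gamma_integrand (pow_pos_le0 (a + b) z0) mul0r mul0e.
  rewrite integral0_eq ?mule0// => x _.
  have [x0|x0] := leP x 0; first by rewrite pow_pos_le0// mul0r.
  rewrite (pow_pos_le0 b) ?mulr0// subr_le0; lra.
rewrite integral_convol_pow// muleA -EFinM /gamma_integrand pow_posE// mulrC //.
Qed.
End beta_integral.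

(** * The Gamma function: functional equation, finiteness, growth and Beta integrals *)

Section gamma.
Context {R : realType}.
Notation mu := (@lebesgue_measure R).
Implicit Types a b t M x : R.

Lemma egammaE a : egamma a = (\int[mu]_(s in `]0%R, +oo[) (s `^ (a - 1) * expR (- s))%:E)%E.
Proof.
rewrite [RHS]integral_mkcond; apply: eq_integral => x _.
rewrite patchE /gamma_integrand /pow_pos indicE.
by case: (x \in _); rewrite ?mul1r ?mul0r.
Qed.

Lemma egamma1 : egamma 1 = 1%E :> \bar R.
Proof.
rewrite egammaE -(@integral_exponential_pdf R 1 ltr01).
rewrite integral_itv_obnd_cbnd; last first.
  apply/measurable_EFinP; apply: measurable_funM.
    by apply: measurable_funTS; exact: measurable_powR.
  apply: measurable_funTS; apply: (measurableT_comp (@measurable_expR R)).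
  exact: oppr_measurable.
rewrite integral_mkcond; apply: eq_integral => x _.
rewrite /exponential_pdf !patchE; case: ifP => // _.
by rewrite subrr powRr0 mulN1r.
Qed.

(** Beyond [M] the power is at least its value at [M], and the tail of [expR (- x)] there has
    integral [expR (- M)]; this tail is a translate of the integrand of [egamma 1]. With [M] free,
    the bound later yields growth faster than any geometric sequence. *)
Lemma ge_egamma a M : 1 <= a -> 0 < M -> ((M `^ (a - 1) * expR (- M))%:E <= egamma a)%E.
Proof.
move=> a1 M0.
have mg : measurable_fun setT (fun x : R => (gamma_integrand 1 (x - M))%:E).
  apply/measurable_EFinP; apply: (measurableT_comp (measurable_gamma_integrand 1)).
  exact: measurable_funB.
have -> : ((M `^ (a - 1) * expR (- M))%:E =
    \int[mu]_x ((M `^ (a - 1) * expR (- M))%:E * (gamma_integrand 1 (x - M))%:E))%E.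
  rewrite (@ge0_integralZl _ _ R mu setT measurableT _ mg); last 2 first.
  - by move=> x _; rewrite lee_fin gamma_integrand_ge0.
  - by rewrite lee_fin mulr_ge0 ?powR_ge0 ?expR_ge0.
  have := @ge0_integral_affine R (fun x => (gamma_integrand 1 (x - M))%:E) 1 M ltr01 mg.
  move=> ->; last by move=> x; rewrite lee_fin gamma_integrand_ge0.
  under eq_integral do rewrite mul1r addrK.
  by rewrite -/(egamma 1) egamma1 !mule1.
apply: ge0_le_integral => //.
- move=> x _; rewrite -EFinM lee_fin mulr_ge0 ?gamma_integrand_ge0//.
  by rewrite mulr_ge0 ?powR_ge0 ?expR_ge0.
- exact: measurable_funeM.
- by apply/measurable_EFinP; exact: measurable_gamma_integrand.
move=> x _; rewrite -EFinM lee_fin /gamma_integrand.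
have [xM|xM] := leP x M.
  by rewrite pow_pos_le0 ?subr_le0// mul0r mulr0 mulr_ge0 ?pow_pos_ge0 ?expR_ge0.
have x0 : 0 < x by exact: lt_trans xM.
rewrite !pow_posE ?subr_gt0// subrr powRr0 mul1r -mulrA -expRD.
rewrite (_ : - M + - (x - M) = - x); last by ring.
rewrite ler_wpM2r ?expR_ge0//.
by apply: ge0_ler_powR; rewrite ?nnegrE ?subr_ge0//; exact: ltW.
Qed.

(* With the cut-offs [expR (- n)] the remainders in [ebeta_1] are geometric. *)
Lemma itv01_bigcup :
  (\bigcup_n [set` `[expR (- n.+1%:R), 1]] = [set` `]0%R, 1%R]] :> set R).
Proof.
apply/seteqP; split => x /=.
  move=> [n _] /=; rewrite !in_itv/= => /andP[h ->]; rewrite andbT.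
  exact: lt_le_trans h; rewrite expR_gt0.
rewrite in_itv/= => /andP[x0 x1].
exists (Num.truncn (- ln x)) => //=; rewrite in_itv/= x1 andbT.
rewrite -[leRHS](@lnK R x) ?posrE//.
rewrite ler_expR lerNl ltW// truncnS_gt//.
Qed.

(** For [a < 1] the integrand is unbounded at [0]: the fundamental theorem of calculus is used on
    compact intervals, and monotone convergence lets the cut-off tend to [0]. *)
Lemma ebeta_1 a : 0 < a -> ebeta a 1 = (a^-1)%:E.
Proof.
move=> a0.
have mp : measurable_fun setT (fun x : R => (x `^ (a - 1))%:E).
  by apply/measurable_EFinP; exact: measurable_powR.
have -> : ebeta a 1 = (\int[mu]_(x in `]0%R, 1%R]) (x `^ (a - 1))%:E)%E.
  rewrite -integral_itv_bndo_bndc; last exact: measurable_funTS.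
  rewrite [RHS]integral_mkcond; apply: eq_integral => x _.
  rewrite patchE; case: ifPn => [|/negP]; rewrite inE/= in_itv/=.
    by move=> /andP[x0 x1]; rewrite !pow_posE ?subr_gt0// subrr powRr0 mulr1.
  move=> /negP; rewrite negb_and -!leNgt => /orP[h|h].
    by rewrite pow_pos_le0// mul0r.
  by rewrite (pow_pos_le0 1) ?mulr0// subr_le0.
have FTC n : (\int[mu]_(x in `[expR (- n.+1%:R), 1%R]) (x `^ (a - 1))%:E)%E
    = (a^-1 * (1 - expR (- a) ^+ n.+1))%:E.
  have e0 : 0 < expR (- n.+1%:R) :> R by exact: expR_gt0.
  have D x : 0 < x -> is_derive x 1 (fun y => a^-1 * y `^ a) (x `^ (a - 1)).
    move=> x0; have H := is_derive1_powR a x0.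
    have := is_deriveZ a^-1 H; rewrite /GRing.scale/= mulrA mulVf ?gt_eqF// mul1r; exact.
  have C x : 0 < x -> {for x, continuous (fun y => a^-1 * y `^ a)}.
    move=> /D h; apply/differentiable_continuous/derivable1_diffP.
    by case: h.
  have C' x : 0 < x -> {for x, continuous (fun y => y `^ (a - 1))}.
    move=> /(is_derive1_powR (a - 1)) h; apply/differentiable_continuous/derivable1_diffP.
    by case: h.
  rewrite (@continuous_FTC2 R _ (fun y => a^-1 * y `^ a)).
  - rewrite -EFinB; congr EFin; rewrite powR1 mulrBr; congr (_ - _ * _).
    rewrite /powR gt_eqF// expRK -expRM_natl mulrN mulrC -mulNr; congr expR; ring.
  - by rewrite expR_lt1 oppr_lt0.
  - apply: continuous_in_subspaceT => x; rewrite inE/= in_itv/= => /andP[h _].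
    apply: C'; exact: lt_le_trans h.
  - split.
    + move=> x; rewrite in_itv/= => /andP[h _].
      by have [] := D x (lt_trans e0 h).
    + apply: cvg_at_right_filter; exact: C.
    + apply: cvg_at_left_filter; exact: C.
  - move=> x; rewrite in_itv/= => /andP[h _].
    by rewrite derive1E; have [_ ->] := D x (lt_trans e0 h).
have := @ge0_nondecreasing_set_cvg_integral _ _ R
  (fun n => [set` `[expR (- n.+1%:R), 1%R]] : set (measurableTypeR R))
  (fun x => (x `^ (a - 1))%:E) mu.
rewrite itv01_bigcup => /(_ _ _ _ _)/cvg_lim <- //; first last.
- by move=> n x _; rewrite lee_fin powR_ge0.
- by move=> n; exact: measurable_funTS.
- move=> n m nm; rewrite subsetEset; apply: subset_itv => //.
  by rewrite bnd_simp ler_expR lerN2 ler_nat.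
apply/cvg_lim => //; under eq_fun do rewrite FTC.
suff h : a^-1 * (1 - expR (- a) ^+ n.+1) @[n --> \oo] --> a^-1 * (1 - 0).
  by rewrite subr0 mulr1 in h; apply: cvg_EFin => //; exact: nearW.
apply: cvgM; first exact: cvg_cst.
apply: cvgB; first exact: cvg_cst.
have := @cvg_expr R (expR (- a)).
rewrite ger0_norm ?expR_ge0// expR_lt1 oppr_lt0 => /(_ a0).
by rewrite -(cvg_shiftS (fun n => expR (- a) ^+ n)).
Qed.

(** The functional equation is the case [b = 1] of [ebeta_egamma], with the factor supplied by
    [ebeta_1] in place of an integration by parts. *)
Lemma egammaD1 a : 0 < a -> egamma (a + 1) = (a%:E * egamma a)%E.
Proof.
move=> a0; have := ebeta_egamma a 1; rewrite egamma1 mule1 => <-.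
by rewrite ebeta_1// muleA -EFinM mulfV ?gt_eqF// mul1e.
Qed.

(** After taking logarithms this is [ln y <= y - 1] at [y = x / (2 * q)], with slack. *)
Lemma powR_le_expR (q x : R) : 0 < q -> 0 < x -> x `^ q <= (2 * q) `^ q * expR (x / 2).
Proof.
move=> q0 x0; have q2 : 0 < 2 * q by rewrite mulr_gt0.
rewrite /powR !gt_eqF// -expRD ler_expR -lerBlDl -mulrBr.
rewrite -ln_div ?posrE//.
have := @le_ln1Dx R (x / (2 * q) - 1).
rewrite addrCA subrr addr0 ltrBrDr addNr => /(_ (divr_gt0 x0 q2)) h.
apply: (@le_trans _ _ (q * (x / (2 * q)))).
  by rewrite ler_pM2l// (le_trans h)// lerBlDr lerDl.
by rewrite le_eqVlt; apply/orP; left; apply/eqP; field; rewrite gt_eqF.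
Qed.

(** Below [1] the integrand is dominated by that of [ebeta a 1], and from [1] on by a multiple of
    [expR (- x / 2)]. *)
Lemma egamma_lty a : 0 < a -> (egamma a < +oo)%E.
Proof.
(* The exponent [q] is positive, as [powR_le_expR] demands, and exceeds [a - 1], so it may replace
   [a - 1] for [x >= 1]. *)
move=> a0; set q := 1 + a; have q0 : 0 < q by rewrite addr_gt0.
pose C := (2 * q) `^ q.
have mg : measurable_fun setT (fun x => (gamma_integrand 1 (2^-1 * x + 0 : R))%:E).
  apply/measurable_EFinP; apply: (measurableT_comp (measurable_gamma_integrand 1)).
  by apply: measurable_funD => //; exact: measurable_funM.
have C0 : 0 <= C by exact: powR_ge0.
apply: (@le_lt_trans _ _ (\int[mu]_x ((pow_pos a x * pow_pos 1 (1 - x))%:E +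
   C%:E * (gamma_integrand 1 (2^-1 * x + 0))%:E))%E).
  apply: ge0_le_integral => //.
  - by move=> x _; rewrite lee_fin gamma_integrand_ge0.
  - by apply/measurable_EFinP; exact: measurable_gamma_integrand.
  - apply: emeasurable_funD; last exact: measurable_funeM.
    by apply/measurable_EFinP; exact: measurable_convol_pow.
  move=> x _; rewrite -EFinM -EFinD lee_fin addr0 /gamma_integrand.
  have [x0|x0] := leP x 0.
    rewrite (@pow_pos_le0 _ a)// (@pow_pos_le0 _ 1 (2^-1 * x)); last by rewrite pmulr_rle0.
    by rewrite !mul0r mulr0 addr0.
  rewrite !(pow_posE _ x0) (@pow_posE _ 1 (2^-1 * x)); last by rewrite mulr_gt0 ?invr_gt0.
  rewrite subrr powRr0 mul1r.
  have [x1|x1] := ltP x 1.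
    rewrite pow_posE ?subr_gt0// subrr powRr0 mulr1.
    apply: (@le_trans _ _ (x `^ (a - 1))); last first.
      by rewrite lerDl mulr_ge0 ?expR_ge0.
    by rewrite ler_piMr ?powR_ge0// expR_le1 oppr_le0 ltW.
  rewrite pow_pos_le0 ?subr_le0// mulr0 add0r.
  apply: (@le_trans _ _ (C * expR (x / 2) * expR (- x))); last first.
    rewrite -mulrA -expRD ler_wpM2l// ler_expR; lra.
  rewrite ler_wpM2r ?expR_ge0// (le_trans _ (powR_le_expR q0 x0))//.
  by apply: ler_powR => //; rewrite /q; lra.
rewrite ge0_integralD//; first last.
- exact: measurable_funeM.
- by move=> x _; rewrite -EFinM lee_fin mulr_ge0 ?gamma_integrand_ge0.
- by apply/measurable_EFinP; exact: measurable_convol_pow.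
- by move=> x _; rewrite lee_fin mulr_ge0 ?pow_pos_ge0.
rewrite -/(ebeta a 1) ebeta_1// (@ge0_integralZl _ _ R mu setT measurableT _ mg)//; last first.
  by move=> x _; rewrite lee_fin gamma_integrand_ge0.
have h2 : 0 < 2^-1 :> R by rewrite invr_gt0.
have := @ge0_integral_affine R (fun x => (gamma_integrand 1 x)%:E) _ 0 h2.
rewrite -/(egamma 1) egamma1.
move=> H.
have {}H : (1 = 2^-1%:E * \int[mu]_x (gamma_integrand 1 (2^-1 * x + 0)%R)%:E :> \bar R)%E.
  apply: H.
    by apply/measurable_EFinP; exact: measurable_gamma_integrand.
  by move=> x; rewrite lee_fin gamma_integrand_ge0.
(* By [H] half of this integral equals [1], which excludes infinite values. *)
case: (\int[mu]_x _)%E H => [r| |] H; first by rewrite -EFinM -EFinD ltry.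
- by move: H; rewrite gt0_muley ?lte_fin.
- by move: H; rewrite gt0_muleNy ?lte_fin.
Qed.

(** Finiteness makes the real-valued [Gamma] faithful to [egamma]; the extended identities pass to
    the reals through this equation. *)
Lemma EFin_Gamma a : 0 < a -> (Gamma a)%:E = egamma a.
Proof.
move=> a0; rewrite egammaE fineK// ge0_fin_numE -?egammaE ?egamma_ge0//.
exact: egamma_lty.
Qed.

Lemma Gamma1 : Gamma 1 = 1 :> R.
Proof. by apply: EFin_inj; rewrite EFin_Gamma ?egamma1. Qed.

Lemma GammaD1 a : 0 < a -> Gamma (a + 1) = a * Gamma a.
Proof.
by move=> a0; apply: EFin_inj; rewrite EFinM !EFin_Gamma ?egammaD1// addr_gt0.
Qed.

Lemma ge_Gamma a M : 1 <= a -> 0 < M -> M `^ (a - 1) * expR (- M) <= Gamma a.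
Proof.
by move=> a1 M0; rewrite -lee_fin EFin_Gamma ?ge_egamma// (lt_le_trans ltr01).
Qed.

(** The lower bound [ge_Gamma] asks for an argument at least [1], so positivity is obtained at
    [a + 1] and brought down by the functional equation. *)
Lemma Gamma_gt0 a : 0 < a -> 0 < Gamma a.
Proof.
move=> a0; rewrite -(pmulr_rgt0 _ a0) -GammaD1//.
apply: (@lt_le_trans _ _ (1 `^ (a + 1 - 1) * expR (- 1))).
  by rewrite powR1 mul1r expR_gt0.
by apply: ge_Gamma => //; rewrite lerDr ltW.
Qed.

Lemma Gamma_nat n : Gamma (1 + n%:R) = n`!%:R :> R.
Proof.
elim: n => [|n IH]; first by rewrite addr0 Gamma1.
by rewrite addrC GammaD1 -?natr1 1?addrC ?IH ?factS ?natrM -?natr1 1?addrC// ltr_wpDl.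
Qed.

Lemma ebetaE a b : 0 < a -> 0 < b -> ebeta a b = (Gamma a * Gamma b / Gamma (a + b))%:E.
Proof.
move=> a0 b0; have := ebeta_egamma a b.
have g0 := Gamma_gt0 (addr_gt0 a0 b0).
rewrite -!EFin_Gamma ?addr_gt0// -EFinM.
case: (ebeta a b) => [r| |].
- by move=> [<-]; rewrite mulfK// gt_eqF.
- by rewrite gt0_mulye ?lte_fin.
- by rewrite gt0_mulNye ?lte_fin.
Qed.

Lemma integral_beta a b t : 0 < a -> 0 < b -> 0 < t ->
  (\int[mu]_(s in `]0%R, t[) (s `^ (a - 1) * (t - s) `^ (b - 1))%:E =
   (t `^ (a + b - 1) * (Gamma a * Gamma b / Gamma (a + b)))%:E)%E.
Proof.
move=> a0 b0 t0; rewrite EFinM -ebetaE// -integral_convol_pow//.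
rewrite integral_mkcond; apply: eq_integral => x _.
rewrite patchE; case: ifPn => [|/negP]; rewrite inE/= in_itv/=.
  by move=> /andP[x0 x1]; rewrite !pow_posE ?subr_gt0.
move=> /negP; rewrite negb_and -!leNgt => /orP[h|h].
  by rewrite pow_pos_le0// mul0r.
by rewrite (@pow_pos_le0 _ b) ?mulr0// subr_le0.
Qed.

Lemma integrable_beta a b t : 0 < a -> 0 < b -> 0 < t ->
  mu.-integrable `]0, t[ (fun s => (s `^ (a - 1) * (t - s) `^ (b - 1))%:E).
Proof.
move=> a0 b0 t0; apply/integrableP; split.
  apply/measurable_EFinP/measurable_funTS; apply: measurable_funM.
    exact: measurable_powR.
  apply: (measurableT_comp (@measurable_powR R _)); exact: measurable_funB.
under eq_integral => s _ do rewrite gee0_abs ?lee_fin ?mulr_ge0 ?powR_ge0//.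
by rewrite integral_beta// ltry.
Qed.
End gamma.

(** * Trigonometric polynomials of degree 2 *)

Section trig.
Context {R : realType}.
Notation mu := (@lebesgue_measure R).
Implicit Types x y : R.

Lemma freq_4pi k : freq (4 * pi) k = k%:R / 2 :> R.
Proof.
(* [pi] is abstracted because [field] would unfold it. *)
by rewrite /freq; move: (pi) (lt0r_neq0 (pi_gt0 R)) => p p0; field.
Qed.

Lemma sin_int2pi (z : int) : sin (z%:~R * (2 * pi)) = 0 :> R.
Proof.
have H n : sin (n%:R * (2 * pi)) = 0 :> R.
  rewrite (_ : n%:R * _ = 0 + (pi *+ 2) *+ n); last by rewrite add0r !mulr_natl.
  by rewrite (periodicn (@sinD2pi R)) sin0.
by case: z => n; rewrite ?NegzE ?mulrNz ?mulNr ?sinN ?H ?oppr0.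
Qed.

Lemma cos_int2pi (z : int) : cos (z%:~R * (2 * pi)) = 1 :> R.
Proof.
have H n : cos (n%:R * (2 * pi)) = 1 :> R.
  rewrite (_ : n%:R * _ = 0 + (pi *+ 2) *+ n); last by rewrite add0r !mulr_natl.
  by rewrite (periodicn (@cosD2pi R)) cos0.
by case: z => n; rewrite ?NegzE ?mulrNz ?mulNr ?cosN ?H.
Qed.

Lemma is_derive_sinM (w x : R) : is_derive x 1 (fun y => sin (w * y)) (w * cos (w * x)).
Proof.
have H : is_derive x 1 (fun y : R => w * y) w.
  by apply: is_derive_eq; rewrite /GRing.scale/= mulr1.
have := @is_derive1_comp R sin (fun y : R => w * y) x _ _ (is_derive_sin _) H.
by rewrite mulrC.
Qed.

Lemma is_derive_cosM (w x : R) : is_derive x 1 (fun y => cos (w * y)) (- (w * sin (w * x))).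
Proof.
have H : is_derive x 1 (fun y : R => w * y) w.
  by apply: is_derive_eq; rewrite /GRing.scale/= mulr1.
have := @is_derive1_comp R cos (fun y : R => w * y) x _ _ (is_derive_cos _) H.
by rewrite mulNr mulrC.
Qed.

Lemma is_derive_continuous (f : R -> R) x d : is_derive x 1 f d -> {for x, continuous f}.
Proof. by case=> h _; apply/differentiable_continuous/derivable1_diffP. Qed.

Lemma continuous_sinM (w : R) : continuous (fun y => sin (w * y)).
Proof. by move=> x; exact: is_derive_continuous (is_derive_sinM w x). Qed.

Lemma continuous_cosM (w : R) : continuous (fun y => cos (w * y)).
Proof. by move=> x; exact: is_derive_continuous (is_derive_cosM w x). Qed.

Lemma Rintegral_FTC2 (f F : R -> R) (a b : R) : a < b -> continuous f ->
  (forall x, is_derive x 1 F (f x)) ->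
  \int[mu]_(y in `[a, b]) f y = F b - F a.
Proof.
move=> ab cf dF; have cF : continuous F by move=> x; exact: is_derive_continuous (dF x).
rewrite /Rintegral (@continuous_FTC2 _ _ F)//.
- exact: continuous_subspaceT.
- split.
  + by move=> x _; case: (dF x).
  + by apply: cvg_at_right_filter; exact: cF.
  + by apply: cvg_at_left_filter; exact: cF.
- by move=> x _; rewrite derive1E; case: (dF x).
Qed.

Let pi4 : 0 < 4 * pi :> R. Proof. by rewrite mulr_gt0 ?pi_gt0. Qed.

(** Integer frequencies are allowed because the product-to-sum formulas produce differences
    [m - n]. *)
Lemma Rintegral_cosM (z : int) :
  \int[mu]_(y in `[0, 4 * pi]) cos (z%:~R / 2 * y) = if z == 0 then 4 * pi else 0.
Proof.
case: eqVneq => [->|z0].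
  have D x : is_derive x 1 id (cos (0%:~R / 2 * x)).
    by rewrite !mul0r cos0; exact: is_derive_id.
  by rewrite (Rintegral_FTC2 pi4 (continuous_cosM (w := _)) D) subr0.
have w0 : z%:~R / 2 != 0 :> R by rewrite mulf_neq0 ?intr_eq0.
have D x : is_derive x 1 (fun y => (z%:~R / 2)^-1 * sin (z%:~R / 2 * y)) (cos (z%:~R / 2 * x)).
  have := is_deriveZ (z%:~R / 2)^-1 (is_derive_sinM (z%:~R / 2) x).
  by rewrite /GRing.scale/= mulrA mulVf// mul1r.
rewrite (Rintegral_FTC2 pi4 (continuous_cosM (w := _)) D).
rewrite mulr0 sin0 (_ : _ * (4 * pi) = z%:~R * (2 * pi)); last by field.
by rewrite sin_int2pi mulr0 subrr.
Qed.

Lemma Rintegral_sinM (z : int) :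
  \int[mu]_(y in `[0, 4 * pi]) sin (z%:~R / 2 * y) = 0.
Proof.
have [->|z0] := eqVneq z 0.
  under eq_Rintegral do rewrite !mul0r sin0.
  by rewrite /Rintegral integral0.
have w0 : z%:~R / 2 != 0 :> R by rewrite mulf_neq0 ?intr_eq0.
have D x : is_derive x 1 (fun y => - (z%:~R / 2)^-1 * cos (z%:~R / 2 * y)) (sin (z%:~R / 2 * x)).
  have := is_deriveZ (- (z%:~R / 2)^-1) (is_derive_cosM (z%:~R / 2) x).
  by rewrite /GRing.scale/= mulrNN mulrA mulVf// mul1r.
rewrite (Rintegral_FTC2 pi4 (continuous_sinM (w := _)) D).
rewrite mulr0 cos0 (_ : _ * (4 * pi) = z%:~R * (2 * pi)); last by field.
by rewrite cos_int2pi subrr.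
Qed.

Lemma continuous_integrable_itv (f : R -> R) (a b : R) : continuous f ->
  mu.-integrable `[a, b] (EFin \o f).
Proof.
move=> cf; apply: continuous_compact_integrable; first exact: segment_compact.
exact: continuous_subspaceT.
Qed.

Lemma Rintegral_lin (f g h : R -> R) (a b p q : R) :
  continuous f -> continuous g -> (forall y, h y = p * f y + q * g y) ->
  \int[mu]_(y in `[a, b]) h y =
  p * \int[mu]_(y in `[a, b]) f y + q * \int[mu]_(y in `[a, b]) g y.
Proof.
move=> cf cg /funext ->.
have Hf := @continuous_integrable_itv f a b cf.
have Hg := @continuous_integrable_itv g a b cg.
rewrite RintegralD//; first by rewrite !RintegralZl.
  by apply: continuous_integrable_itv => x; apply: cvgM; [exact: cvg_cst|exact: cf].
by apply: continuous_integrable_itv => x; apply: cvgM; [exact: cvg_cst|exact: cg].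
Qed.

(** In the product-to-sum formula [0 < n] makes the frequency [m + n] nonzero, so only the term in
    [m - n] can contribute. *)
Lemma Rintegral_cos_cos m n : (0 < n)%N ->
  \int[mu]_(y in `[0, 4 * pi]) (cos (m%:R / 2 * y) * cos (n%:R / 2 * y)) = 2 * pi *+ (m == n).
Proof.
move=> n0.
have E y : cos (m%:R / 2 * y) * cos (n%:R / 2 * y) =
    2^-1 * cos ((m%:Z - n%:Z)%:~R / 2 * y) + 2^-1 * cos ((m%:Z + n%:Z)%:~R / 2 * y).
  rewrite rmorphB rmorphD /= -!pmulrn !mulrDl mulNr mulNr cosD cosN sinN cosD; by field.
rewrite (Rintegral_lin _ _ (continuous_cosM (w := _)) (continuous_cosM (w := _)) E).
rewrite !Rintegral_cosM subr_eq0 eqz_nat -PoszD eqz_nat addn_eq0 (gtn_eqF n0) andbF.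
move: (pi) => p; case: eqP => _ /=; rewrite ?mulr1n ?mulr0n ?mulr0 ?addr0//; by field.
Qed.

Lemma Rintegral_sin_sin m n : (0 < n)%N ->
  \int[mu]_(y in `[0, 4 * pi]) (sin (m%:R / 2 * y) * sin (n%:R / 2 * y)) = 2 * pi *+ (m == n).
Proof.
move=> n0.
have E y : sin (m%:R / 2 * y) * sin (n%:R / 2 * y) =
    2^-1 * cos ((m%:Z - n%:Z)%:~R / 2 * y) + (- 2^-1) * cos ((m%:Z + n%:Z)%:~R / 2 * y).
  rewrite rmorphB rmorphD /= -!pmulrn !mulrDl mulNr mulNr cosD cosN sinN cosD; by field.
rewrite (Rintegral_lin _ _ (continuous_cosM (w := _)) (continuous_cosM (w := _)) E).
rewrite !Rintegral_cosM subr_eq0 eqz_nat -PoszD eqz_nat addn_eq0 (gtn_eqF n0) andbF.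
move: (pi) => p; case: eqP => _ /=; rewrite ?mulr1n ?mulr0n ?mulr0 ?addr0//; by field.
Qed.

Lemma Rintegral_sin_cos m n :
  \int[mu]_(y in `[0, 4 * pi]) (sin (m%:R / 2 * y) * cos (n%:R / 2 * y)) = 0.
Proof.
have E y : sin (m%:R / 2 * y) * cos (n%:R / 2 * y) =
    2^-1 * sin ((m%:Z - n%:Z)%:~R / 2 * y) + 2^-1 * sin ((m%:Z + n%:Z)%:~R / 2 * y).
  rewrite rmorphB rmorphD /= -!pmulrn !mulrDl mulNr mulNr sinD cosN sinN sinD; by field.
rewrite (Rintegral_lin _ _ (continuous_sinM (w := _)) (continuous_sinM (w := _)) E).
by rewrite !Rintegral_sinM !mulr0 addr0.
Qed.

(** For the period [4 * pi] these are the modes [0], [1] and [2]. The family contains the products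
    of its members with [a2 = b2 = 0]. *)
Definition trig2 (a0 a1 b1 a2 b2 y : R) : R :=
  a0 + a1 * cos (y / 2) + b1 * sin (y / 2) + a2 * cos y + b2 * sin y.

(** The constant becomes the cosine of mode [0], so that every term has the shape of the
    orthogonality relations. *)
Lemma trig2E a0 a1 b1 a2 b2 : trig2 a0 a1 b1 a2 b2 =
  (fun y => a0 * cos (0%:R / 2 * y) +
    (a1 * cos (1%:R / 2 * y) + b1 * sin (1%:R / 2 * y) +
    (a2 * cos (2%:R / 2 * y) + b2 * sin (2%:R / 2 * y)))).
Proof.
apply/funext => y; rewrite /trig2 !mul0r cos0 mulr1 mulfV// !mul1r [2^-1 * y]mulrC.
ring.
Qed.

Section coef.
Variables a0 a1 b1 a2 b2 : R.
Notation f := (trig2 a0 a1 b1 a2 b2).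

Lemma is_derive_trig2 x : is_derive x 1 f
  (- (a1 / 2 * sin (x / 2)) + b1 / 2 * cos (x / 2) - a2 * sin x + b2 * cos x).
Proof.
rewrite trig2E.
have D k (a b : R) := is_deriveD (is_deriveZ a (is_derive_cosM (k%:R / 2) x))
  (is_deriveZ b (is_derive_sinM (k%:R / 2) x)).
have {}D := is_deriveD (is_deriveZ a0 (is_derive_cosM (0%:R / 2) x))
  (is_deriveD (D 1%N a1 b1) (D 2%N a2 b2)).
apply: (is_derive_eq D).
rewrite /GRing.scale/= !mul0r mulfV// !mul1r [2^-1 * x]mulrC; ring.
Qed.

Lemma derive_trig2 x : 'D_1 f x =
  - (a1 / 2 * sin (x / 2)) + b1 / 2 * cos (x / 2) - a2 * sin x + b2 * cos x.
Proof. by have [] := is_derive_trig2 x. Qed.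

Lemma derivable_trig2 x : derivable f x 1.
Proof. by have [] := is_derive_trig2 x. Qed.

Lemma continuous_trig2 : continuous f.
Proof. by move=> x; exact: is_derive_continuous (is_derive_trig2 x). Qed.

Lemma periodic_trig2 : periodic f (4 * pi).
Proof.
move=> y; rewrite /trig2.
have -> : (y + 4 * pi) / 2 = y / 2 + pi *+ 2 by rewrite -mulr_natl; field.
have -> : y + 4 * pi = y + pi *+ 2 + pi *+ 2 by rewrite -mulr_natl; ring.
by rewrite !cosD2pi !sinD2pi.
Qed.

(** The factors [1] keep each sum in the shape [p * _ + q * _] to which [Rintegral_lin] applies. *)
Let Rintegral_trig2M (g : R -> R) (cg : continuous g) :
  \int[mu]_(y in `[0, 4 * pi]) (f y * g y) =
    a0 * \int[mu]_(y in `[0, 4 * pi]) (cos (0%:R / 2 * y) * g y) +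
    1 * (1 * (a1 * \int[mu]_(y in `[0, 4 * pi]) (cos (1%:R / 2 * y) * g y) +
      b1 * \int[mu]_(y in `[0, 4 * pi]) (sin (1%:R / 2 * y) * g y)) +
    1 * (a2 * \int[mu]_(y in `[0, 4 * pi]) (cos (2%:R / 2 * y) * g y) +
      b2 * \int[mu]_(y in `[0, 4 * pi]) (sin (2%:R / 2 * y) * g y))).
Proof.
have cc m : continuous (fun y => cos (m%:R / 2 * y) * g y).
  by move=> x; apply: cvgM; [exact: continuous_cosM|exact: cg].
have cs m : continuous (fun y => sin (m%:R / 2 * y) * g y).
  by move=> x; apply: cvgM; [exact: continuous_sinM|exact: cg].
have cl (h k : R -> R) p q :
    continuous h -> continuous k -> continuous (fun y => p * h y + q * k y).
  by move=> ch ck x; apply: cvgD; apply: cvgM; try exact: cvg_cst; [exact: ch|exact: ck].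
have c1 := cl _ _ a1 b1 (cc 1%N) (cs 1%N); have c2 := cl _ _ a2 b2 (cc 2%N) (cs 2%N).
rewrite -(Rintegral_lin _ _ (cc 1%N) (cs 1%N) (fun=> erefl)).
rewrite -(Rintegral_lin _ _ (cc 2%N) (cs 2%N) (fun=> erefl)).
rewrite -(Rintegral_lin _ _ c1 c2 (fun=> erefl)).
apply: (Rintegral_lin _ _ (cc 0%N) (cl _ _ 1 1 c1 c2)) => y; rewrite trig2E; ring.
Qed.

Lemma fourier_cos_trig2 k : (0 < k)%N ->
  fourier_cos (4 * pi) f k = a1 *+ (k == 1)%N + a2 *+ (k == 2)%N.
Proof.
move=> k0; rewrite /fourier_cos freq_4pi Rintegral_trig2M; last exact: continuous_cosM.
rewrite !Rintegral_sin_cos !Rintegral_cos_cos// (ltn_eqF k0) ![_ == k]eq_sym.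
move: (pi) (lt0r_neq0 (pi_gt0 R)) => p p0.
case: k k0 => [|[|[|k]]] //= _; rewrite ?mulr1n ?mulr0n; by field.
Qed.

Lemma fourier_sin_trig2 k : (0 < k)%N ->
  fourier_sin (4 * pi) f k = b1 *+ (k == 1)%N + b2 *+ (k == 2)%N.
Proof.
move=> k0; rewrite /fourier_sin freq_4pi Rintegral_trig2M; last exact: continuous_sinM.
have E m : \int[mu]_(y in `[0, 4 * pi]) (cos (m%:R / 2 * y) * sin (k%:R / 2 * y)) = 0.
  by under eq_Rintegral do rewrite mulrC; exact: Rintegral_sin_cos.
rewrite !E !Rintegral_sin_sin// ![_ == k]eq_sym.
move: (pi) (lt0r_neq0 (pi_gt0 R)) => p p0.
case: k k0 {E} => [|[|[|k]]] //= _; rewrite ?mulr1n ?mulr0n; by field.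
Qed.

(** The partial sums are constant from index [3] on. Mode [2] has frequency [1], so its coefficients
    are unchanged. *)
Lemma frac_laplacian_trig2 alpha : 0 < alpha ->
  frac_laplacian (4 * pi) alpha f = trig2 0 (2^-1 `^ alpha * a1) (2^-1 `^ alpha * b1) a2 b2.
Proof.
move=> al0; apply/funext => x; rewrite /frac_laplacian.
apply: (lim_near_cst (@norm_hausdorff _ _)).
exists 3%N => //= n /= n3.
rewrite /series/= (@big_cat_nat _ _ _ 3)//= [X in _ + X]big_nat.
rewrite [X in _ + X]big1 ?addr0; last first.
  move=> k /andP[k3 _]; have k0 : (0 < k)%N by exact: leq_trans k3.
  rewrite fourier_cos_trig2// fourier_sin_trig2//.
  by case: k k3 {k0} => [|[|[|k]]]//= _; rewrite !mulr0n !addr0 !mul0r addr0 mulr0.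
(* Mode [0] drops out because [0] to the power [alpha] is [0] for [alpha > 0]; its Fourier
   coefficients are never evaluated. *)
rewrite 3?big_nat_recr//= big_geq// add0r !freq_4pi !mul0r powR0 ?gt_eqF// mul0r add0r.
rewrite !fourier_cos_trig2// !fourier_sin_trig2//= !mulr1n !mulr0n mulfV// powR1 !mul1r /trig2.
rewrite [2^-1 * x]mulrC; ring.
Qed.

Lemma frac_laplacian_dom_trig2 alpha : 0 < alpha -> frac_laplacian_dom (4 * pi) alpha f.
Proof.
move=> al0; split; [exact: periodic_trig2|exact: continuous_trig2|].
apply: (is_cvg_near_cst (\sum_(0 <= k < 3) freq (4 * pi) k `^ alpha *
        (`|fourier_cos (4 * pi) f k| + `|fourier_sin (4 * pi) f k|))).
exists 3%N => //= n /= n3.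
rewrite /series/= (@big_cat_nat _ _ _ 3)//= [X in _ + X]big_nat [X in _ + X]big1 ?addr0//.
move=> k /andP[k3 _]; have k0 : (0 < k)%N by exact: leq_trans k3.
rewrite fourier_cos_trig2// fourier_sin_trig2//.
by case: k k3 {k0} => [|[|[|k]]]//= _; rewrite !mulr0n !addr0 !normr0 addr0 mulr0.
Qed.

End coef.

(** The constant is lost by differentiation, and the terms in [a2] and [b2] cancel since they are
    fixed by the fractional Laplacian. *)
Lemma K22_operator_trig2 a0 a1 b1 a2 b2 alpha x : 0 < alpha ->
  let f := trig2 a0 a1 b1 a2 b2 in
  - derive1 f x + derive1 (frac_laplacian (4 * pi) alpha f) x =
  (1 - 2^-1 `^ alpha) / 2 * (a1 * sin (x / 2) - b1 * cos (x / 2)).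
Proof.
move=> al0 f; rewrite /f frac_laplacian_trig2// !derive1E !derive_trig2; by field.
Qed.
End trig.

(** * Entire series in [t^beta] and their Caputo derivatives *)

Section entire.
Context {R : realType}.
Implicit Types (c p : nat -> R) (x z s t : R).

(** Infinite radius of convergence, phrased as boundedness against every geometric sequence, a form
    that passes directly to the differentiated series. *)
Definition entire_coef c :=
  forall K : R, 0 <= K -> exists M : R, forall n, `|c n| * K ^+ n <= M.

(** Boundedness at radius twice [|z|] gives comparison with a geometric series of ratio one half. *)
Lemma cvg_series_entire c z : entire_coef c -> cvgn (series (fun n => `|c n * z ^+ n|)).
Proof.
move=> ec; have [M HM] := ec (2 * `|z|) (mulr_ge0 (ler0n _ _) (normr_ge0 _)).
have M0 : 0 <= M by apply: le_trans (HM 0%N); rewrite expr0 mulr1.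
apply: (@series_le_cvg _ _ (geometric M 2^-1)) => //.
- by move=> n; rewrite /geometric/= mulr_ge0// exprn_ge0// invr_ge0.
- move=> n; rewrite /geometric/= normrM normrX exprVn ler_pdivlMr ?exprn_gt0//.
  by rewrite -mulrA -exprMn [`|z| * 2]mulrC.
- by apply: is_cvg_geometric_series; rewrite ger0_norm ?invr_ge0// invf_lt1// ltr1n.
Qed.

Lemma is_cvg_pseries_entire c z : entire_coef c -> cvgn (pseries c z).
Proof. by move=> ec; apply: normed_cvg; exact: cvg_series_entire. Qed.

Lemma entire_coef_diffs c : entire_coef c -> entire_coef (pseries_diffs c).
Proof.
(* The factor [2] absorbs the [n + 1] coming from differentiation, and the base [K + 1 >= 1] absorbs
   the shift of the exponent. *)
move=> ec K K0; have K1 : 0 <= 2 * (K + 1) by rewrite mulr_ge0// addr_ge0.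
have [M HM] := ec _ K1; exists M => n; apply: le_trans (HM n.+1).
rewrite /pseries_diffs normrM mulrAC mulrC ler_wpM2l//.
rewrite ger0_norm// exprMn ler_pM ?exprn_ge0//.
  by rewrite -natrX ler_nat ltnW// ltn_expl.
apply: (@le_trans _ _ ((K + 1) ^+ n)).
  by rewrite lerXn2r ?nnegrE ?addr_ge0// lerDl.
by rewrite exprS ler_peMl ?exprn_ge0 ?addr_ge0// lerDr.
Qed.

Lemma is_derive_entire c x : entire_coef c ->
  is_derive x 1 (fun x => limn (pseries c x)) (limn (pseries (pseries_diffs c) x)).
Proof.
move=> ec; apply: (@pseries_snd_diffs R c (`|x| + 1)).
- exact: is_cvg_pseries_entire.
- by apply: is_cvg_pseries_entire; exact: entire_coef_diffs.
- by apply: is_cvg_pseries_entire; do 2 apply: entire_coef_diffs.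
- by rewrite [ltRHS]ger0_norm ?addr_ge0// ltrDl.
Qed.

(** By [ge_Gamma] at [M = N^(1/beta)], the denominator is at least [N^n] times the constant
    [expR (- M)], for any [N >= 1]. *)
Lemma entire_coef_Gamma (beta b A B : R) p : 0 < beta -> 1 <= b -> 0 <= A -> 0 <= B ->
  (forall n, `|p n| <= A * B ^+ n) ->
  entire_coef (fun n => p n / Gamma (b + beta * n%:R)).
Proof.
move=> be0 b1 A0 B0 Hp K K0.
(* The added [1] ensures [M >= 1], so that [M^(beta n)] is at most [M^(b + beta n - 1)]. *)
pose N := B * K + 1; have N1 : 1 <= N by rewrite lerDr mulr_ge0.
have N0 : 0 < N by exact: lt_le_trans N1.
pose M := N `^ beta^-1; have M0 : 0 < M by exact: powR_gt0.
have M1 : 1 <= M.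
  by rewrite -(@powRr0 _ N) ler_powR// invr_ge0 ltW.
exists (A * expR M) => n.
have bn : 1 <= b + beta * n%:R by rewrite (le_trans b1)// lerDl mulr_ge0// ltW.
have G0 : 0 < Gamma (b + beta * n%:R) by apply: Gamma_gt0; exact: lt_le_trans bn.
rewrite normrM normfV (gtr0_norm G0) mulrAC ler_pdivrMr//.
apply: (@le_trans _ _ (A * N ^+ n)).
  apply: (@le_trans _ _ (A * B ^+ n * K ^+ n)).
    by rewrite ler_wpM2r ?exprn_ge0.
  rewrite -mulrA -exprMn ler_wpM2l// lerXn2r ?nnegrE ?mulr_ge0//; first exact: ltW.
  by rewrite lerDl.
rewrite -mulrA ler_wpM2l//.
have := ge_Gamma bn M0; rewrite expRN ler_pdivrMr ?expR_gt0// [leRHS]mulrC; apply: le_trans.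
apply: (@le_trans _ _ (M `^ (beta * n%:R))).
  by rewrite -powRrM mulrA mulVf ?gt_eqF// mul1r powR_mulrn// ltW.
by rewrite ler_powR// addrAC lerDr subr_ge0.
Qed.
End entire.

(** Coordinates in the functions [t^(beta n) / Gamma (1 + beta n)], on which the Caputo derivative
    of order [beta] acts by shifting [p]. *)
Definition gamma_coef {R : realType} (beta : R) (p : nat -> R) (n : nat) : R :=
  p n / Gamma (1 + beta * n%:R).

Section caputo_series.
Context {R : realType}.
Notation mu := (@lebesgue_measure R).
Variables (beta : R) (p : nat -> R) (A B : R).
Hypotheses (be0 : 0 < beta) (A0 : 0 <= A) (B0 : 0 <= B)
  (Hp : forall n, `|p n| <= A * B ^+ n).

Notation c := (gamma_coef beta p).
Notation d := (gamma_coef beta (p \o S)).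

Lemma entire_gamma_coef : entire_coef c.
Proof. exact: entire_coef_Gamma Hp. Qed.

Variable f : R -> R.
Hypothesis Hf : forall s, 0 <= s -> f s = limn (pseries c (s `^ beta)).

Let df s := limn (pseries (pseries_diffs c) (s `^ beta)) * (beta * s `^ (beta - 1)).

Lemma is_derive_gamma_series (s : R) : 0 < s -> is_derive s 1 f (df s).
Proof.
move=> s0.
have D1 := @is_derive1_comp R _ (@powR R ^~ beta) s _ _
  (is_derive_entire (s `^ beta) entire_gamma_coef) (is_derive1_powR beta s0).
apply: near_eq_is_derive D1.
near=> r; rewrite Hf//= ltW//; near: r; exact: lt_nbhsr.
Unshelve. all: by end_near. Qed.

Lemma continuous_gamma_series : {within `[0, +oo[, continuous f}.
Proof.
apply/continuous_within_itvcyP; split.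
  move=> s; rewrite in_itv/= andbT => s0; exact: is_derive_continuous (is_derive_gamma_series s0).
rewrite Hf// powR0 ?gt_eqF//.
apply: (@cvg_trans _ (limn (pseries c (s `^ beta)) @[s --> 0^'+])).
  apply: near_eq_cvg; near=> s; rewrite Hf// ltW//.
have C : {for 0, continuous (fun z => limn (pseries c z))}.
  exact: is_derive_continuous (is_derive_entire 0 entire_gamma_coef).
exact: (cvg_comp _ _ (powR_cvg0 be0) C).
Unshelve. all: by end_near. Qed.

(** The functional equation of [Gamma] cancels the factor [beta (n + 1)] produced by
    differentiation. The remaining [Gamma (beta (n + 1))] is the one supplied by the Beta
    integral. *)
Lemma diffs_gamma_coef n : pseries_diffs c n * beta * Gamma (beta * n.+1%:R) = p n.+1.
Proof.
have b0 : 0 < beta * n.+1%:R by rewrite mulr_gt0.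
rewrite /pseries_diffs /gamma_coef [1 + _]addrC GammaD1//.
have := Gamma_gt0 b0; move: (Gamma _) => g g0.
by field; rewrite !gt_eqF// ltr0n.
Qed.

Lemma powR_split (s : R) n : 0 < s ->
  s `^ (beta * n.+1%:R - 1) = (s `^ beta) ^+ n * s `^ (beta - 1).
Proof.
move=> s0; rewrite -powR_mulrn ?powR_ge0// -powRrM -powRD; last by rewrite (gt_eqF s0) implybT.
by congr powR; rewrite -natr1; ring.
Qed.

Lemma cvg_derive_gamma_series s : 0 < s ->
  \sum_(0 <= n < N) (pseries_diffs c n * beta * s `^ (beta * n.+1%:R - 1)) @[N --> \oo] --> df s.
Proof.
move=> s0.
rewrite [X in X @ _ --> _](_ : _ =
    fun N => pseries (pseries_diffs c) (s `^ beta) N * (beta * s `^ (beta - 1))).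
  apply: cvgM; last exact: cvg_cst.
  by apply: is_cvg_pseries_entire; apply: entire_coef_diffs; exact: entire_gamma_coef.
apply/funext => N; rewrite /pseries /series /= mulr_suml; apply: eq_bigr => n _.
rewrite powR_split//; ring.
Qed.

Section lt1.
Hypothesis be1 : beta < 1.
Variable t : R.
Hypothesis t0 : 0 < t.

(** Partial sums of the Caputo integrand of [f], kernel included. *)
Let h N s :=
  (\sum_(0 <= n < N) pseries_diffs c n * beta * s `^ (beta * n.+1%:R - 1)) * (t - s) `^ (- beta).

(** Each term is a Beta integral with parameters [beta (n + 1)] and [1 - beta], whose sum is the
    [1 + beta n] in the denominators of [d]. Integrability is carried along because additivity of
    the integral uses it. *)
Lemma integral_partial_sum N : mu.-integrable `]0, t[ (EFin \o h N) /\
  (\int[mu]_(s in `]0%R, t[) (h N s)%:E = (Gamma (1 - beta) * pseries d (t `^ beta) N)%:E)%E.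
Proof.
have hE0 : h 0 = cst 0 by apply/funext => s; rewrite /h big_geq ?mul0r.
have hES M : h M.+1 = (fun s => h M s + (pseries_diffs c M * beta) *
    (s `^ (beta * M.+1%:R - 1) * (t - s) `^ ((1 - beta) - 1))).
  apply/funext => s; rewrite /h big_nat_recr//= mulrDl; congr (_ + _).
  by rewrite (_ : 1 - beta - 1 = - beta) ?mulrA//; ring.
elim: N => [|N [IH1 IH2]].
  rewrite hE0 /pseries /series/= big_geq// mulr0; split; last by rewrite integral0_eq.
  exact: integrable0.
have b0 : 0 < beta * N.+1%:R by rewrite mulr_gt0.
have b1 : 0 < 1 - beta by rewrite subr_gt0.
have I1 := integrable_beta b0 b1 t0.
have I2 : mu.-integrable `]0, t[ (fun s => (pseries_diffs c N * beta)%:E *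
    (s `^ (beta * N.+1%:R - 1) * (t - s) `^ ((1 - beta) - 1))%:E)%E.
  by apply: integrableZl I1; exact: measurable_itv.
have E : (EFin \o h N.+1) = (fun s => (EFin \o h N) s + ((pseries_diffs c N * beta)%:E *
    (s `^ (beta * N.+1%:R - 1) * (t - s) `^ ((1 - beta) - 1))%:E))%E.
  by apply/funext => s; rewrite /= hES EFinD EFinM.
split; first by rewrite E; exact: integrableD.
transitivity (\int[mu]_(s in `]0%R, t[) (EFin \o h N.+1) s)%E => //.
rewrite E integralD// IH2 integralZl// integral_beta//.
rewrite -EFinM -EFinD; congr EFin.
rewrite /pseries /series/= big_nat_recr//= mulrDr; congr (_ + _).
rewrite (_ : beta * N.+1%:R + (1 - beta) - 1 = beta * N%:R); last by rewrite -natr1; ring.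
rewrite (_ : beta * N.+1%:R + (1 - beta) = 1 + beta * N%:R); last by rewrite -natr1; ring.
rewrite powRrM powR_mulrn ?powR_ge0// /gamma_coef /= -(diffs_gamma_coef N); ring.
Qed.

Lemma caputo_gamma_series_lt1 :
  caputo_derivable beta f t /\ caputo beta f t = limn (pseries d (t `^ beta)).
Proof.
rewrite /caputo_derivable /caputo (lt_eqF be1).
have C1 : cvgn (series (fun n => `|pseries_diffs c n * (t `^ beta) ^+ n|)).
  by apply: cvg_series_entire; apply: entire_coef_diffs; exact: entire_gamma_coef.
(* Since [s^beta <= t^beta] for [s < t], this [C] bounds the partial sums of the differentiated
   series on the whole interval. *)
pose C := limn (series (fun n => `|pseries_diffs c n * (t `^ beta) ^+ n|)).
have b1 : 0 < 1 - beta by rewrite subr_gt0.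
have g1 := Gamma_gt0 b1.
have I1 := integrable_beta be0 b1 t0.
have I2 : mu.-integrable `]0, t[ (fun s => (C * beta)%:E *
    (s `^ (beta - 1) * (t - s) `^ (1 - beta - 1))%:E)%E.
  by apply: integrableZl I1; exact: measurable_itv.
have mh N : measurable_fun (`]0, t[ : set (measurableTypeR R)) (EFin \o h N).
  by have [/integrableP[]] := integral_partial_sum N.
have hcvg s : `]0, t[%classic s ->
    (EFin \o h N) s @[N --> \oo] --> (derive1 f s * (t - s) `^ (- beta))%:E.
  rewrite /= in_itv/= => /andP[s0 st].
  apply: cvg_EFin; first exact: nearW.
  rewrite derive1E; have [_ ->] := is_derive_gamma_series s0.
  by apply: cvgM; [exact: cvg_derive_gamma_series|exact: cvg_cst].
have mf := @emeasurable_fun_cvg _ (measurableTypeR R) R `]0, t[%classic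
  (fun N => EFin \o h N) (fun s => (derive1 f s * (t - s) `^ (- beta))%:E) mh hcvg.
have dom s N : `]0, t[%classic s -> (`|(EFin \o h N) s| <=
    (C * beta)%:E * (s `^ (beta - 1) * (t - s) `^ (1 - beta - 1))%:E)%E.
  rewrite /= in_itv/= => /andP[s0 st]; rewrite -EFinM lee_fin.
  rewrite (_ : 1 - beta - 1 = - beta); last by ring.
  rewrite /h normrM [`|(t - s) `^ _|]ger0_norm ?powR_ge0// mulrA ler_wpM2r ?powR_ge0//.
  apply: le_trans (ler_norm_sum _ _ _) _.
  apply: (@le_trans _ _ (series (fun n => `|pseries_diffs c n * (t `^ beta) ^+ n|) N *
      beta * s `^ (beta - 1))).
    rewrite /series/= -mulrA mulr_suml; apply: ler_sum => n _.
    rewrite powR_split// !normrM (ger0_norm (ltW be0)) !(ger0_norm (powR_ge0 _ _)).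
    rewrite mulrA [X in _ <= X]mulrA ler_wpM2r ?powR_ge0// mulrAC ler_wpM2r ?(ltW be0)//.
    rewrite ler_wpM2l// !ger0_norm ?exprn_ge0 ?powR_ge0//.
    rewrite lerXn2r ?nnegrE ?powR_ge0//.
    by apply: ge0_ler_powR; rewrite ?nnegrE ltW.
  rewrite ler_wpM2r ?powR_ge0// ler_wpM2r ?(ltW be0)//.
  apply: nondecreasing_cvgn_le => //; apply: nondecreasing_series => n _ _.
  exact: normr_ge0.
have cvg_ae : {ae mu, forall s, `]0, t[%classic s ->
    (EFin \o h N) s @[N --> \oo] --> (derive1 f s * (t - s) `^ (- beta))%:E}.
  by apply: aeW => s; exact: hcvg.
have dom_ae : {ae mu, forall s N, `]0, t[%classic s -> (`|(EFin \o h N) s| <=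
    (C * beta)%:E * (s `^ (beta - 1) * (t - s) `^ (1 - beta - 1))%:E)%E}.
  by apply: aeW => s N; exact: dom.
have [J1 _ J3] := @dominated_convergence _ (measurableTypeR R) R mu _ (measurable_itv `]0, t[)
  _ _ _ mh mf cvg_ae I2 dom_ae.
split.
  split; last exact: J1.
  by move=> s; rewrite in_itv/= => /andP[s0 _]; have [] := is_derive_gamma_series s0.
rewrite /Rintegral.
(* The integrals of the partial sums are known in closed form, so their limit identifies the Caputo
   integral. *)
have J4 : (Gamma (1 - beta) * pseries d (t `^ beta) N)%:E @[N --> \oo] -->
    (\int[mu]_(s in `]0%R, t[) (derive1 f s * (t - s) `^ (- beta))%:E)%E.
  apply: cvg_trans J3; apply: near_eq_cvg; apply: nearW => N /=.
  by have [_ <-] := integral_partial_sum N.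
have fin := @integrable_fin_num _ (measurableTypeR R) R mu _ (measurable_itv `]0, t[) _ J1.
move: J4; rewrite -(fineK fin) => /fine_cvg J4.
apply/esym/cvg_lim => //.
rewrite [X in X @ _ --> _](_ : _ = fun N =>
    (Gamma (1 - beta))^-1 * (Gamma (1 - beta) * pseries d (t `^ beta) N)).
  by apply: cvgM; [exact: cvg_cst|exact: J4].
by apply/funext => N /=; rewrite mulrA mulVf ?gt_eqF// mul1r.
Qed.
End lt1.

Lemma caputo_gamma_series t : beta <= 1 -> 0 < t ->
  caputo_derivable beta f t /\ caputo beta f t = limn (pseries d (t `^ beta)).
Proof.
rewrite le_eqVlt => /orP[/eqP b1 t0|b1 t0]; last exact: caputo_gamma_series_lt1.
(* For [beta = 1] the derivative is the ordinary one, and by [diffs_gamma_coef] the differentiated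
   coefficients are already the shifted ones. *)
rewrite /caputo_derivable /caputo b1 eqxx; have [h1 h2] := is_derive_gamma_series t0.
split => //; rewrite derive1E h2 /df b1 subrr powRr0 !mulr1.
congr (limn (pseries _ _)); apply/funext => n.
rewrite /gamma_coef /= -(diffs_gamma_coef n) b1 !mul1r mulr1 -natr1 [1 + _]addrC mulfK//.
by rewrite gt_eqF// Gamma_gt0// natr1 ltr0n.
Qed.
End caputo_series.

(** * The decomposition of the solution *)

Section trig_aux.
Context {R : realType}.

(** [cos_sign n] and [sin_sign n] are the cosine and sine of [n * pi / 2]: the signed profile of
    [u_ n] is the cosine of [x / 2 - n * pi / 2], and each step of the recursion is a quarter
    turn. *)
Definition cos_sign (n : nat) : R := if odd n then 0 else (-1) ^+ n./2.
Definition sin_sign (n : nat) : R := if odd n then (-1) ^+ n./2 else 0.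

Lemma cos_signS n : cos_sign n.+1 = - sin_sign n.
Proof.
rewrite /cos_sign /sin_sign /= uphalf_half; case: (odd n) => /=.
  by rewrite exprS mulN1r.
by rewrite oppr0.
Qed.

Lemma sin_signS n : sin_sign n.+1 = cos_sign n.
Proof. by rewrite /cos_sign /sin_sign /= uphalf_half; case: (odd n). Qed.

Lemma norm_cos_sign n : `|cos_sign n| <= 1.
Proof. by rewrite /cos_sign; case: ifP; rewrite ?normr0// normrX normrN1 expr1n. Qed.

Lemma norm_sin_sign n : `|sin_sign n| <= 1.
Proof. by rewrite /sin_sign; case: ifP; rewrite ?normr0// normrX normrN1 expr1n. Qed.

Lemma K22_psiE n x : (-1) ^+ n./2 * K22_psi n x = cos_sign n * cos x + sin_sign n * sin x.
Proof.
by rewrite /K22_psi /cos_sign /sin_sign; case: (odd n); rewrite mul0r ?add0r ?addr0.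
Qed.

Lemma trig2M (d A B d' A' B' y : R) :
  trig2 d A B 0 0 y * trig2 d' A' B' 0 0 y =
  trig2 (d * d' + (A * A' + B * B') / 2) (d * A' + d' * A) (d * B' + d' * B)
        ((A * A' - B * B') / 2) ((A * B' + A' * B) / 2) y.
Proof.
rewrite /trig2 !mul0r !addr0.
have -> : cos y = cos (y / 2) ^+ 2 - sin (y / 2) ^+ 2.
  by rewrite {1}(_ : y = y / 2 + y / 2) ?cosD; [ring|field].
have -> : sin y = 2 * sin (y / 2) * cos (y / 2).
  by rewrite {1}(_ : y = y / 2 + y / 2) ?sinD; [ring|field].
have := cos2Dsin2 (y / 2); move: (cos _) (sin _) => C S E.
(* Once the constant is multiplied by [C ^+ 2 + S ^+ 2], both sides agree as polynomials in [C] and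
   [S]. *)
have -> : (A * A' + B * B') / 2 = (A * A' + B * B') / 2 * (C ^+ 2 + S ^+ 2).
  by rewrite E mulr1.
by field.
Qed.

Lemma trig2_sum n (a0 a1 b1 a2 b2 : 'I_n -> R) y :
  \sum_(k < n) trig2 (a0 k) (a1 k) (b1 k) (a2 k) (b2 k) y =
  trig2 (\sum_(k < n) a0 k) (\sum_(k < n) a1 k) (\sum_(k < n) b1 k)
        (\sum_(k < n) a2 k) (\sum_(k < n) b2 k) y.
Proof. by rewrite /trig2 !big_split/= -!mulr_suml. Qed.

(** Only [u_ 0] has a constant part, so the frequency [1/2] part of [w_n] comes from the end terms
    [i = 0] and [i = n]. For [n = 0] they coincide, and both summands of the single term count. *)
Lemma sum_delta_conv n (k : R) (A : nat -> R) :
  \sum_(i < n.+1) (k *+ (i == 0 :> nat) * A (n - i)%N + k *+ (n - i == 0)%N * A i) =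
  2 * k * A n.
Proof.
rewrite big_split/= big_ord_recl/= subn0 big1 ?addr0 => [|i _]; last by rewrite mulr0n mul0r.
rewrite big_ord_recr/= subnn eqxx big1 ?add0r => [|i _]; last first.
  by rewrite subn_eq0 leqNgt ltn_ord mulr0n mul0r.
rewrite !mulr1n; ring.
Qed.

Lemma cos2_quarter (x : R) : cos (x / 4) ^+ 2 = (1 + cos (x / 2)) / 2.
Proof.
rewrite (_ : x / 2 = (x / 4) *+ 2); last by rewrite -mulr_natl; field.
by rewrite cos_mulr2n -mulr_natl; field.
Qed.

Lemma powR_half (alpha : R) : 2^-1 `^ alpha = (2 `^ alpha)^-1.
Proof.
have h : 2 `^ alpha != 0 :> R by rewrite gt_eqF// powR_gt0.
by apply: (mulIf h); rewrite mulVf// -powRM ?invr_ge0// mulVf// powR1.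
Qed.

Lemma cvg_pseries_lin (q a0 a b : nat -> R) (k0 k1 k2 z l0 l1 l2 : R) :
  (forall n, q n = k0 * a0 n + (k1 * a n + k2 * b n)) ->
  pseries a0 z @ \oo --> l0 -> pseries a z @ \oo --> l1 -> pseries b z @ \oo --> l2 ->
  limn (pseries q z) = k0 * l0 + (k1 * l1 + k2 * l2).
Proof.
move=> E h0 h1 h2; apply/cvg_lim => //.
rewrite [X in X @ _ --> _](_ : _ = fun N =>
    k0 * pseries a0 z N + (k1 * pseries a z N + k2 * pseries b z N)).
  by apply: cvgD; [|apply: cvgD]; apply: cvgM => //; exact: cvg_cst.
apply/funext => N; rewrite /pseries /series/= !mulr_sumr -!big_split/=.
by apply: eq_bigr => n _; rewrite E; ring.
Qed.

Lemma cvg_pseries_delta (z : R) : pseries (fun n => (n == 0%N)%:R) z @ \oo --> (1 : R).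
Proof.
apply: cvg_near_cst; exists 1%N => //= -[//|n] _.
rewrite /pseries /series/= big_nat_recl//= expr0 mulr1 big1 ?addr0// => i _.
by rewrite mul0r.
Qed.

(** The terms are grouped in consecutive pairs, which convergence of the full series permits; in
    each pair only the even index survives. *)
Lemma mittag_leffler_even (beta z : R) : 0 < beta ->
  limn (series (fun n => cos_sign n * z ^+ n / Gamma (1 + beta * n%:R))) =
  mittag_leffler (2 * beta) 1 (- z ^+ 2).
Proof.
move=> be0.
have cf : cvgn (series (fun n => cos_sign n * z ^+ n / Gamma (1 + beta * n%:R))).
  have := @is_cvg_pseries_entire R _ 1 (@entire_gamma_coef R beta
    (fun n => cos_sign n * z ^+ n) 1 `|z| be0 ler01 (normr_ge0 _) _).
  rewrite /pseries; under eq_fun do rewrite expr1n mulr1.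
  by apply => n; rewrite normrM normrX ler_pM// norm_cos_sign.
rewrite -(cvg_lim _ (cvg_series_cvg_series_group cf (isT : 0 < 2)%N))// /mittag_leffler.
congr (limn (series _)); apply/funext => n /=.
rewrite big_ltn ?ltn_pmul2r// big_ltn ?mulSn ?addSn// big_geq// addr0.
rewrite /cos_sign /= muln2 odd_double/= !mul0r addr0 doubleK.
rewrite [in RHS]exprNn -[in RHS]exprM mul2n; congr (_ * _ / Gamma _).
rewrite -muln2 natrM; ring.
Qed.

Lemma is_cvg_mittag_leffler (a b z : R) : 0 < a -> 1 <= b ->
  cvgn (series (fun n => z ^+ n / Gamma (a * n%:R + b))).
Proof.
move=> a0 b1.
have := @is_cvg_pseries_entire R _ z (@entire_coef_Gamma R a b 1 1 (fun=> 1) a0 b1 ler01 ler01 _).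
rewrite /pseries; under eq_fun do rewrite mul1r mulrC [b + _]addrC.
by apply => n; rewrite normr1 expr1n mulr1.
Qed.

Lemma mittag_leffler_odd (beta z : R) : 0 < beta ->
  limn (series (fun n => sin_sign n * z ^+ n / Gamma (1 + beta * n%:R))) =
  z * mittag_leffler (2 * beta) (1 + beta) (- z ^+ 2).
Proof.
move=> be0.
have cf : cvgn (series (fun n => sin_sign n * z ^+ n / Gamma (1 + beta * n%:R))).
  have := @is_cvg_pseries_entire R _ 1 (@entire_gamma_coef R beta
    (fun n => sin_sign n * z ^+ n) 1 `|z| be0 ler01 (normr_ge0 _) _).
  rewrite /pseries; under eq_fun do rewrite expr1n mulr1.
  by apply => n; rewrite normrM normrX ler_pM// norm_sin_sign.
rewrite -(cvg_lim _ (cvg_series_cvg_series_group cf (isT : 0 < 2)%N))//.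
apply/cvg_lim => //.
have cm := @is_cvg_mittag_leffler (2 * beta) (1 + beta) (- z ^+ 2).
rewrite [X in X @ _ --> _](_ : _ = fun N =>
    z * series (fun n => (- z ^+ 2) ^+ n / Gamma (2 * beta * n%:R + (1 + beta))) N).
  by apply: cvgM; [exact: cvg_cst|apply: cm; rewrite ?mulr_gt0// lerDl ltW].
apply/funext => N; rewrite /series/= mulr_sumr; apply: eq_bigr => n _.
rewrite big_ltn ?ltn_pmul2r// big_ltn ?mulSn ?addSn// big_geq// addr0.
rewrite /sin_sign /= muln2 odd_double/= !mul0r add0r uphalf_double.
rewrite exprS [in RHS]exprNn -exprM mul2n.
rewrite (_ : 1 + beta * n.*2.+1%:R = 2 * beta * n%:R + (1 + beta)); first ring.
rewrite -muln2 -natr1 natrM; ring.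
Qed.

Lemma mittag_leffler_cos (z : R) : mittag_leffler 2 1 (- z ^+ 2) = cos z.
Proof.
rewrite -(cvg_lim _ (@cvg_cos_coeff' R z))// /mittag_leffler.
congr (limn (series _)); apply/funext => n.
rewrite /cos_coeff' addrC -natrM Gamma_nat mul2n exprNn -exprM mul2n//.
Qed.

Lemma mittag_leffler_sin (z : R) : z * mittag_leffler 2 2 (- z ^+ 2) = sin z.
Proof.
rewrite -(cvg_lim _ (@cvg_sin_coeff' R z))// /mittag_leffler.
apply/esym/cvg_lim => //.
rewrite [X in X @ _ --> _](_ : _ = fun N =>
    z * series (fun n => (- z ^+ 2) ^+ n / Gamma (2 * n%:R + 2)) N).
  by apply: cvgM; [exact: cvg_cst|apply: is_cvg_mittag_leffler; rewrite ?ler1n].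
apply/funext => N; rewrite /series/= mulr_sumr; apply: eq_bigr => n _.
rewrite /sin_coeff' (_ : 2 * n%:R + 2 = 1 + n.*2.+1%:R); last first.
  by rewrite -[n.*2.+1%:R]natr1 -mul2n natrM; ring.
rewrite Gamma_nat [in RHS]exprNn -exprM mul2n exprS -exprnP; ring.
Qed.
End trig_aux.

(** * Solution of the recursion, its sum, and the fractional equation *)

Section K22_decomposition.
Context {R : realType}.
Variables (alpha beta c : R) (u_ : nat -> R -> R -> R).
Hypotheses (al0 : 0 < alpha) (be0 : 0 < beta) (be1 : beta <= 1).
Hypothesis hu : K22_recursion (4 * pi) alpha beta c u_.

Let gamma : R := 2 `^ (1 - alpha) * (2 `^ alpha - 1) / 3.
(** Both the mean and the amplitude of [u_ 0], by the half-angle formula. *)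
Let k3 : R := 2 * c / 3.
Let g n t : R := k3 * (gamma * c) ^+ n * t `^ (beta * n%:R) / Gamma (1 + beta * n%:R).
Let u x t := limn (series (fun n => u_ n x t)).
(** Numerators of the solution at fixed [x] as a series in [t^beta], split into constant, cosine and
    sine parts. *)
Let P x n : R := k3 * (n == 0%N)%:R +
  (k3 * cos (x / 2) * ((gamma * c) ^+ n * cos_sign n) +
   k3 * sin (x / 2) * ((gamma * c) ^+ n * sin_sign n)).
Let EA t := mittag_leffler (2 * beta) 1 (- (gamma * c * t `^ beta) ^+ 2).
Let EB t := gamma * c * t `^ beta *
  mittag_leffler (2 * beta) (1 + beta) (- (gamma * c * t `^ beta) ^+ 2).

(** This is the factor gained at each step of the recursion: [(1 - 2^(-alpha)) / 2] from
    [K22_operator_trig2] times [2 * k3] from [sum_delta_conv]. *)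
Lemma K22_gammaE : gamma * c = (1 - 2^-1 `^ alpha) * k3.
Proof.
have h : 2 `^ alpha != 0 :> R by rewrite gt_eqF// powR_gt0.
rewrite powR_half /gamma /k3 powRD; last by rewrite pnatr_eq0 implybT.
by rewrite powRr1// powRN; field.
Qed.

Lemma K22_u_trig2 n : forall y t, 0 <= t ->
  u_ n y t = trig2 (k3 *+ (n == 0%N)) (g n t * cos_sign n) (g n t * sin_sign n) 0 0 y.
Proof.
have [hu0 huS] := hu.
elim/ltn_ind: n => -[|n] IH y t t0.
  rewrite hu0// /trig2 /g /cos_sign /sin_sign /= !mulr0 powRr0 addr0 Gamma1 mulr1n cos2_quarter.
  by rewrite !expr0 /k3; field.
rewrite huS// add0r mulr0n.
(* All five coefficients of [w_n] are recorded, but only the two of frequency [1/2] survive the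
   operator, and these involve no amplitude other than [g n]. *)
have W s : 0 <= s -> (fun y => K22_w u_ n y s) = trig2
   (\sum_(k < n.+1) (k3 *+ (k == 0 :> nat) * (k3 *+ (n - k == 0)%N) +
      (g k s * cos_sign k * (g (n - k)%N s * cos_sign (n - k)) +
       g k s * sin_sign k * (g (n - k)%N s * sin_sign (n - k))) / 2))
   (2 * k3 * (g n s * cos_sign n)) (2 * k3 * (g n s * sin_sign n))
   (\sum_(k < n.+1) ((g k s * cos_sign k * (g (n - k)%N s * cos_sign (n - k)) -
       g k s * sin_sign k * (g (n - k)%N s * sin_sign (n - k))) / 2))
   (\sum_(k < n.+1) ((g k s * cos_sign k * (g (n - k)%N s * sin_sign (n - k)) +
       g (n - k)%N s * cos_sign (n - k) * (g k s * sin_sign k)) / 2)).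
  move=> s0; apply/funext => x; rewrite /K22_w.
  rewrite -(sum_delta_conv n k3 (fun n => g n s * cos_sign n)).
  rewrite -(sum_delta_conv n k3 (fun n => g n s * sin_sign n)) -trig2_sum.
  by apply: eq_bigr => k _; rewrite IH ?ltn_ord// IH ?ltnS ?leq_subr// trig2M.
(* At [t = 0] the integral is over an empty interval, and [g] vanishes because its exponent is
   nonzero; the Beta integral asks for [t > 0]. *)
have [->|tn0] := eqVneq t 0.
  rewrite /g powR0 ?mulf_neq0 ?gt_eqF// mulr0 !mul0r set_itv_ge ?bnd_simp ?ltxx//.
  by rewrite Rintegral_set0 mulr0 /trig2 !mul0r !addr0.
have {t0}tn0 : 0 < t by rewrite lt_neqAle eq_sym tn0.
have b0 : 0 < 1 + beta * n%:R by rewrite ltr_pwDl// mulr_ge0// ltW.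
have b1 : 0 < 1 + beta * n.+1%:R by rewrite ltr_pwDl// mulr_ge0// ltW.
have G0 := lt0r_neq0 (Gamma_gt0 b0); have G1 := lt0r_neq0 (Gamma_gt0 b1).
have G2 := lt0r_neq0 (Gamma_gt0 be0).
(* The part of the integrand independent of [s]; the operator has turned the signs of index [n] into
   those of index [n.+1]. *)
pose K := gamma * c * (k3 * (gamma * c) ^+ n / Gamma (1 + beta * n%:R)) *
  (cos_sign n.+1 * cos (y / 2) + sin_sign n.+1 * sin (y / 2)).
rewrite (_ : \int[_]_(s in _) _ = \int[lebesgue_measure]_(s in `]0, t[)
    (K * (s `^ (1 + beta * n%:R - 1) * (t - s) `^ (beta - 1)))); last first.
  apply: eq_Rintegral => s; rewrite inE/= in_itv/= => /andP[s0 _].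
  rewrite W ?ltW// K22_operator_trig2// [RHS]mulrA; congr (_ * _).
  rewrite /K /g K22_gammaE cos_signS sin_signS.
  rewrite (_ : 1 + beta * n%:R - 1 = beta * n%:R); last by ring.
  by move: (Gamma _) G0 => G0 ?; field.
rewrite RintegralZl//; last exact: integrable_beta.
(* Of the Beta integral, [Gamma beta] cancels the prefactor of the integrated problem and
   [Gamma (1 + beta n)] the denominator of [g n], which leaves the denominator of [g n.+1]. *)
rewrite /Rintegral integral_beta//= /K /g /trig2.
rewrite (_ : 1 + beta * n%:R + beta - 1 = beta * n.+1%:R); last by rewrite -natr1; ring.
rewrite (_ : 1 + beta * n%:R + beta = 1 + beta * n.+1%:R); last by rewrite -natr1; ring.
rewrite exprS; move: (Gamma _) (Gamma _) (Gamma _) G0 G1 G2 => G0 G1 G2 ? ? ?.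
by field; do ?[apply/andP; split].
Qed.

Lemma K22_uE n x t : 0 <= t -> u_ n x t = gamma_coef beta (P x) n * (t `^ beta) ^+ n.
Proof.
move=> t0; have E : (t `^ beta) ^+ n = t `^ (beta * n%:R).
  by rewrite -powR_mulrn ?powR_ge0// -powRrM.
rewrite K22_u_trig2// /trig2 /g /gamma_coef /P E.
have [->|n0] := eqVneq n 0%N.
  by rewrite /= mulr1n mulr0 powRr0 addr0 Gamma1 invr1; ring.
by rewrite /= mulr0n; ring.
Qed.

Lemma K22_P_bound x n : `|P x n| <= 3 * `|k3| * `|gamma * c| ^+ n.
Proof.
have C1 := @norm_cos_sign R n; have S1 := @norm_sin_sign R n.
rewrite /P; move: (gamma * c) => b.
have bd k v w : `|v| <= 1 -> `|w| <= 1 -> `|k * v * (b ^+ n * w)| <= `|k| * `|b| ^+ n.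
  move=> v1 w1; rewrite !normrM normrX -mulrA ler_wpM2l// mulrCA ler_piMr ?exprn_ge0//.
  by rewrite mulr_ile1.
rewrite (_ : 3 * _ * _ =
  `|k3| * `|b| ^+ n + (`|k3| * `|b| ^+ n + `|k3| * `|b| ^+ n)); last by ring.
apply: le_trans (ler_normD _ _) _; apply: lerD.
  rewrite normrM ler_wpM2l//.
  by case: n {C1 S1 bd} => [|n]; rewrite ?normr1 ?expr0// normr0 exprn_ge0.
by apply: le_trans (ler_normD _ _) _; apply: lerD; apply: bd; rewrite ?cos_max ?sin_max.
Qed.

Lemma K22_series_cvg x t : 0 <= t -> cvgn (series (fun n => `|u_ n x t|)).
Proof.
move=> t0; under eq_fun do rewrite K22_uE//.
apply: cvg_series_entire; apply: (@entire_gamma_coef _ _ _ (3 * `|k3|) `|gamma * c|) => //.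
by move=> n; exact: K22_P_bound.
Qed.

Lemma K22_u_pseries x t : 0 <= t -> u x t = limn (pseries (gamma_coef beta (P x)) (t `^ beta)).
Proof.
by move=> t0; rewrite /u; congr (limn (series _)); apply/funext => n; rewrite K22_uE.
Qed.

Lemma cvg_cos_part t :
  pseries (gamma_coef beta (fun n => (gamma * c) ^+ n * cos_sign n)) (t `^ beta) @ \oo --> EA t.
Proof.
rewrite /EA -mittag_leffler_even//.
rewrite [X in limn (series X)](_ : _ = fun n =>
    gamma_coef beta (fun n => (gamma * c) ^+ n * cos_sign n) n * (t `^ beta) ^+ n); last first.
  by apply/funext => n; rewrite /gamma_coef exprMn; ring.
apply: is_cvg_pseries_entire; apply: (@entire_gamma_coef _ _ _ 1 `|gamma * c|) => // n.
by rewrite mul1r normrM normrX ler_piMr ?exprn_ge0// norm_cos_sign.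
Qed.

Lemma cvg_sin_part t :
  pseries (gamma_coef beta (fun n => (gamma * c) ^+ n * sin_sign n)) (t `^ beta) @ \oo --> EB t.
Proof.
rewrite /EB -mittag_leffler_odd//.
rewrite [X in limn (series X)](_ : _ = fun n =>
    gamma_coef beta (fun n => (gamma * c) ^+ n * sin_sign n) n * (t `^ beta) ^+ n); last first.
  by apply/funext => n; rewrite /gamma_coef exprMn; ring.
apply: is_cvg_pseries_entire; apply: (@entire_gamma_coef _ _ _ 1 `|gamma * c|) => // n.
by rewrite mul1r normrM normrX ler_piMr ?exprn_ge0// norm_sin_sign.
Qed.

Lemma K22_u_closed x t : 0 <= t -> u x t = k3 * (1 + cos (x / 2) * EA t + sin (x / 2) * EB t).
Proof.
move=> t0; rewrite K22_u_pseries//.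
rewrite (@cvg_pseries_lin R _ (fun n => (n == 0%N)%:R) _ _ k3
  (k3 * cos (x / 2)) (k3 * sin (x / 2)) _ _ _ _
  _ (@cvg_pseries_delta _ _) (@cvg_cos_part t) (@cvg_sin_part t)); first ring.
move=> n; rewrite /gamma_coef /P; case: n => [|n]; last by rewrite mulr0; ring.
by rewrite (_ : 1 + beta * 0%:R = 1) ?Gamma1 ?invr1; [ring|rewrite mulr0 addr0].
Qed.

(** Shifting [P x] by one index removes the constant part, multiplies by [gamma * c] and makes a
    quarter turn, which exchanges the roles of [EA] and [EB] up to sign. *)
Lemma K22_caputo x t : 0 < t ->
  caputo_derivable beta (u x) t /\
  caputo beta (u x) t = gamma * c * k3 * (EA t * sin (x / 2) - EB t * cos (x / 2)).
Proof.
move=> t0.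
have A0 : 0 <= 3 * `|k3| by rewrite mulr_ge0.
have [h1 h2] := @caputo_gamma_series R beta (P x) _ _ be0 A0 (normr_ge0 _) (K22_P_bound x) (u x)
  (fun s s0 => K22_u_pseries x s0) t be1 t0.
split => //; rewrite h2.
rewrite (@cvg_pseries_lin R _ (fun n => (n == 0%N)%:R) _ _ 0
  (gamma * c * k3 * sin (x / 2)) (- (gamma * c * k3 * cos (x / 2))) _ _ _ _
  _ (@cvg_pseries_delta _ _) (@cvg_cos_part t) (@cvg_sin_part t)); first ring.
by move=> n; rewrite /gamma_coef /P /= cos_signS sin_signS exprS mulr0; ring.
Qed.

Lemma K22_is_solution : K22_solution (4 * pi) alpha beta u.
Proof.
have A0 : 0 <= 3 * `|k3| by rewrite mulr_ge0.
split.
  move=> x; exact: (@continuous_gamma_series R beta (P x) _ _ be0 A0 (normr_ge0 _) (K22_P_bound x) (u x)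
    (fun s s0 => K22_u_pseries x s0)).
move=> x t t0; have [h1 h2] := K22_caputo x t0.
(* At fixed [t] the solution has modes [0] and [1] only, so its square is again a [trig2], with
   frequency [1/2] part linear in [EA] and [EB]. *)
have E : (fun y => u y t ^+ 2) = trig2
    (k3 * k3 + (k3 * EA t * (k3 * EA t) + k3 * EB t * (k3 * EB t)) / 2)
    (k3 * (k3 * EA t) + k3 * (k3 * EA t)) (k3 * (k3 * EB t) + k3 * (k3 * EB t))
    ((k3 * EA t * (k3 * EA t) - k3 * EB t * (k3 * EB t)) / 2)
    ((k3 * EA t * (k3 * EB t) + k3 * EA t * (k3 * EB t)) / 2).
  apply/funext => y; rewrite -trig2M -expr2 K22_u_closed ?ltW//; congr (_ ^+ 2).
  by rewrite /trig2; ring.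
split => //.
- by rewrite E; exact: frac_laplacian_dom_trig2.
- by rewrite E; exact: derivable_trig2.
- by rewrite E frac_laplacian_trig2//; exact: derivable_trig2.
rewrite E; set f := trig2 _ _ _ _ _.
have := @K22_operator_trig2 R (k3 * k3 + (k3 * EA t * (k3 * EA t) + k3 * EB t * (k3 * EB t)) / 2)
    (k3 * (k3 * EA t) + k3 * (k3 * EA t)) (k3 * (k3 * EB t) + k3 * (k3 * EB t))
    ((k3 * EA t * (k3 * EA t) - k3 * EB t * (k3 * EB t)) / 2)
    ((k3 * EA t * (k3 * EB t) + k3 * EA t * (k3 * EB t)) / 2) alpha x al0.
rewrite -/f /= => H.
rewrite (_ : _ - _ = caputo beta (u x) t
  - (- derive1 f x + derive1 (frac_laplacian (4 * pi) alpha f) x)); last by ring.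
by rewrite H h2 K22_gammaE; field.
Qed.

Lemma K22_initial x : u x 0 = 4 * c / 3 * cos (x / 4) ^+ 2.
Proof.
have [hu0 _] := hu; rewrite -(hu0 x 0)//.
apply: norm_lim_near_cst; exists 1%N => //= -[//|n] _.
rewrite /series/= big_nat_recl//= big1 ?addr0// => i _.
by rewrite K22_u_trig2// /g powR0 ?mulf_neq0 ?gt_eqF// mulr0 !mul0r /trig2 mulr0n !mul0r !addr0.
Qed.

(** Here [gamma * c = c / 2] and the Mittag-Leffler terms become the cosine and sine of [c * t / 2];
    the subtraction formula for the cosine then produces the travelling wave. *)
Lemma K22_travelling x t : alpha = 2 -> beta = 1 -> 0 <= t ->
  u x t = 4 * c / 3 * cos ((x - c * t) / 4) ^+ 2.
Proof.
move=> al2 b1 t0; rewrite K22_u_closed// /EA /EB b1 mulr1 -natr1 -/2.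
rewrite mittag_leffler_cos mittag_leffler_sin.
have -> : gamma * c * t `^ 1 = c * t / 2.
  rewrite K22_gammaE al2 powRr1// powR_mulrn ?invr_ge0// /k3; by field.
rewrite cos2_quarter (_ : (x - c * t) / 2 = x / 2 - c * t / 2); last by ring.
by rewrite cosB /k3; field.
Qed.

Lemma K22_coefE n t : g n t =
  2 `^ (n%:R + 1 - n%:R * alpha) * (2 `^ alpha - 1) ^+ n * c ^+ n.+1 *
    t `^ (beta * n%:R) / (3 ^+ n.+1 * Gamma (1 + beta * n%:R)).
Proof.
have -> : 2 `^ (n%:R + 1 - n%:R * alpha) = 2 * (2 `^ (1 - alpha)) ^+ n :> R.
  rewrite -powR_mulrn ?powR_ge0// -powRrM.
  transitivity (2 `^ 1 * 2 `^ ((1 - alpha) * n%:R) : R); last by rewrite powRr1.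
  by rewrite -powRD ?pnatr_eq0 ?implybT//; congr powR; ring.
have G0 : Gamma (1 + beta * n%:R) != 0.
  by rewrite gt_eqF// Gamma_gt0// ltr_pwDl// mulr_ge0// ltW.
have n3 : 3 ^+ n != 0 :> R by rewrite expf_neq0.
by rewrite /g /k3 /gamma !exprMn exprVn !exprS; field; rewrite G0 n3.
Qed.

Lemma K22_u_formula n x t : (1 <= n)%N -> 0 <= t ->
  u_ n x t = (-1) ^+ n./2 *
    (2 `^ (n%:R + 1 - n%:R * alpha) * (2 `^ alpha - 1) ^+ n * c ^+ n.+1 *
      t `^ (beta * n%:R) / (3 ^+ n.+1 * Gamma (1 + beta * n%:R))) *
    K22_psi n (x / 2).
Proof.
move=> n1 t0; rewrite K22_u_trig2// -K22_coefE [RHS]mulrAC K22_psiE (gtn_eqF n1) /trig2 mulr0n.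
ring.
Qed.
End K22_decomposition.

Theorem mainTheorem2 (R : realType) (alpha beta c : R)
    (u_ : nat -> R -> R -> R)
    (halpha : 0 < alpha <= 2) (hbeta : 0 < beta <= 1)
    (hu : K22_recursion (4 * pi) alpha beta c u_) :
  let gamma : R := 2 `^ (1 - alpha) * (2 `^ alpha - 1) / 3 in
  let u : R -> R -> R := fun x t => limn (series (fun n => u_ n x t)) in
  (forall (n : nat) (x t : R), (1 <= n)%N -> 0 <= t ->
     u_ n x t =
       (-1) ^+ n./2 *
       (2 `^ (n%:R + 1 - n%:R * alpha) * (2 `^ alpha - 1) ^+ n * c ^+ n.+1 *
          t `^ (beta * n%:R) / (3 ^+ n.+1 * Gamma (1 + beta * n%:R))) *
       K22_psi n (x / 2)) /\
  (forall x t : R, 0 <= t -> cvgn (series (fun n => `|u_ n x t|))) /\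
  (forall x t : R, 0 <= t ->
     u x t =
       2 * c / 3 *
       (1 + cos (x / 2) *
              mittag_leffler (2 * beta) 1 (- (gamma * c * t `^ beta) ^+ 2)
          + sin (x / 2) * (gamma * c * t `^ beta) *
              mittag_leffler (2 * beta) (1 + beta)
                (- (gamma * c * t `^ beta) ^+ 2))) /\
  K22_solution (4 * pi) alpha beta u /\
  (forall x : R, u x 0 = 4 * c / 3 * cos (x / 4) ^+ 2) /\
  (alpha = 2 -> beta = 1 ->
     forall x t : R, 0 <= t -> u x t = 4 * c / 3 * cos ((x - c * t) / 4) ^+ 2).
Proof.
have /andP[al0 _] := halpha; have /andP[be0 be1] := hbeta.
move=> gamma u; split; first by move=> n x t; exact: K22_u_formula hu n x t.
split; first by move=> x t; exact: K22_series_cvg hu x t.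
split.
  by move=> x t t0; rewrite /u (K22_u_closed al0 be0 hu)// -[sin _ * _ * _]mulrA.
split; first exact: K22_is_solution hu.
split; first by move=> x; exact: K22_initial hu x.
by move=> al2 b1 x t; exact: K22_travelling hu x t al2 b1.
Qed.
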